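(* For every multiway-join counting query $q=\bowtie_{i=1}^n R_i$, database $D$, authorization view $\mathcal A_c(D)$ (for a fixed context $c$), and smoothing parameter $\beta>0$, the contextual residual sensitivity $\mathrm{CRS}_{q,\mathcal A_c}(D)$ is a $\beta$-smooth upper bound on the contextual local sensitivity $\mathrm{CLS}_{q,\mathcal A_c}(D)$ and satisfies $$\mathrm{CRS}_{q,\mathcal A_c}(D)\le \mathrm{RS}_q(D).$$ Consequently, calibrating the release mechanism to $\mathrm{CRS}_{q,\mathcal A_c}(D)$ yields $(\varepsilon,\delta)$-contextual differential privacy under $\mathcal A_c(D)$.
   Context: **Databases and neighbors.** $|q(I)|$ is the number of tuples in the join $q(I)$ on database instance $I$, and $\Gamma$ denotes the schema integrity constraints. $\mathcal R_{\mathrm{priv}}\subseteq[n]$ indexes the private relations. $I\sim I'$ means that $I,I'$ differ by one elementary edit $\tau$ to one tuple of a private relation. The elementary edits to $R_i$ are insertion $\mathrm{Ins}_i$, deletion $\mathrm{Del}_i$ and value change $\mathrm{Chg}_i$: under add/remove neighborhood $\tau\in\{\mathrm{Ins}_i,\mathrm{Del}_i\}$, under change neighborhood $\tau=\mathrm{Chg}_i$, and combinations of these edits are also allowed. **Contextual neighbors.** For a fixed query context $c$ (sender, recipient, purpose, query), $\mathcal A_c(D)$ is the information (set of database cells) in $D$ that the contextual-integrity policy authorizes to flow under $c$. $D\sim_c D'$ iff $D\sim D'$ and $\mathcal A_c(D)=\mathcal A_c(D')$. A randomized mechanism $\mathcal M$ is $(\varepsilon,\delta)$-contextually differentially private for $c$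 if $\Pr[\mathcal M(D,c)\in O]\le e^{\varepsilon}\Pr[\mathcal M(D',c)\in O]+\delta$ for all $D\sim_c D'$ and measurable $O$. The contextual local sensitivity is $\mathrm{CLS}_{q,\mathcal A_c}(I)=\max_{I':I\sim_c I'}\bigl||q(I)|-|q(I')|\bigr|$. A function $\hat S$ is a $\beta$-smooth upper bound on it if (i) $\hat S(I)\ge \mathrm{CLS}_{q,\mathcal A_c}(I)$ for every $I$, and (ii) $\hat S(I)\le e^{\beta}\hat S(I')$ for every $I\sim_c I'$. **Boundary multiplicities.** For $E\subseteq[n]$, $q_E=\bowtie_{j\in E}R_j$ is the residual query, its boundary $\mathsf B_E$ is the set of attributes connecting $q_E$ to the remaining relations, and $T_E(I)$ is the maximum over $b\in\mathrm{dom}(\mathsf B_E)$ of the number of tuples of $q_E(I)$ matching $b$ ($T_\emptyset=1$). Let $E_i=[n]\setminus\{i\}$, let $\mathsf B_i$ be the boundary for $R_i$ (that of $q_{E_i}$), let $\mathrm m_i(b)$ be the number of tuples of $q_{E_i}(I)$ matching boundary value $b$, and $\mathrm{LS}_i=T_{E_i}(I)=\max_b\mathrm m_i(b)$. Among the boundary values occupied by $R_i$ that remain private (i.e. are occupied by tuples not authorized by $\mathcal A_c$), $\mu^{\mathrm{free}}_{i,1}$ and $\mu^{\mathrm{free}}_{i,\min}$ are the largest and smallest multiplicities $\mathrm m_i(b)$; $M_i^{\mathrm{unocc}}$ is the largest multiplicity $\mathrm m_i(b)$ at a boundary value not currently occupied by $R_i$. **Inference rules.** The public information about $R_i$ given by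 $\mathcal A_c$ has one of the forms $P=\bot$ (nothing public), $R_i$, $\sigma_\varphi(R_i)$, $\pi_{\mathsf B_i}(R_i)$, $\pi_{\mathsf B_i}(\sigma_\varphi(R_i))$. The rules derive, for $P$ and edit $\tau$, a bound $\ell_i$: - (Base) $P=\bot$: $\ell_i=\mathrm{LS}_i$. - (Ins) $\tau=\mathrm{Ins}_i$: $\ell_i=\mathrm{LS}_i$. - (Sel-Del) $P=\sigma_\varphi(R_i)$, $\tau=\mathrm{Del}_i$: $\ell_i=\mu^{\mathrm{free}}_{i,1}$. - (Prj-Chg) $P=\pi_{\mathsf B_i}(R_i)$, $\tau=\mathrm{Chg}_i$: $\ell_i=0$. - (PrjSel-Chg) $P=\pi_{\mathsf B_i}(\sigma_\varphi(R_i))$, $\tau=\mathrm{Chg}_i$: $\ell_i=\max\{T_{E_i}-\mu^{\mathrm{free}}_{i,\min},\,\mu^{\mathrm{free}}_{i,1}\}$. - (Sel) $P=\sigma_\varphi(R_i)$, $\tau=\{\mathrm{Del}_i,\mathrm{Chg}_i\}$: $\ell_i=\max\{T_{E_i}-\mu^{\mathrm{free}}_{i,\min},\,\mu^{\mathrm{free}}_{i,1}\}$. - (Sel-Unique) $P=\sigma_\varphi(R_i)$, $\Gamma$ implies that $\mathsf B_i$ is unique in $R_i$, $\tau\in\{\mathrm{Ins}_i,\mathrm{Del}_i,\mathrm{Chg}_i\}$: $\ell_i=\max\{\mu^{\mathrm{free}}_{i,1},\,M_i^{\mathrm{unocc}}\}$. - (Pub) $P=R_i$, $\tau\in\{\mathrm{Ins}_i,\mathrm{Del}_i,\mathrm{Chg}_i\}$: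 $\ell_i=0$. - (FK) if $R_i$ references the excluded relation $R_E$ through a foreign key, so that referential integrity prevents new boundary values, then $\Gamma$ gives $M_i^{\mathrm{unocc}}=0$. For each private relation $R_i$, $\ell_i(I)$ is the bound given by the inference rule that applies to $R_i$ under $\mathcal A_c$. A relation governed by Pub admits no contextual edit, since any insertion, deletion or change would change $\mathcal A_c$. The contextually editable relations are $\mathcal R^c_{\mathrm{priv}}=\{i\in\mathcal R_{\mathrm{priv}}:\ell_i\text{ is not derived by Pub}\}$. **Residual sensitivities.** $\mathfrak S_k$ is the set of nonnegative integer vectors $\mathbf s$ indexed by $\mathcal R_{\mathrm{priv}}$ with entries summing to $k$ ($s_i$ counts tuple changes to $R_i$), and $\mathfrak S^c_k=\{\mathbf s\in\mathfrak S_k: s_j=0\text{ for all }j\notin\mathcal R^c_{\mathrm{priv}}\}$. $\mathrm{GS}_q=\sup_{I\sim I'}\bigl||q(I)|-|q(I')|\bigr|$ (treated as $\infty$ if unbounded). Then $$\mathrm{LS}_q^{(k)}(I)=\max_{\mathbf s\in\mathfrak S_k}\max_{i\in\mathcal R_{\mathrm{priv}}}\sum_{A\subseteq E_i\cap\mathcal R_{\mathrm{priv}}}T_{E_i\setminus A}(I)\prod_{j\in A}s_j,\qquad \mathrm{RS}_q(I)=\max_{k\ge0}e^{-\beta k}\min\{\mathrm{GS}_q,\mathrm{LS}_q^{(k)}(I)\},$$ $$\widehat{\mathrm{CLS}}{}_q^{(0)}(I)=\max_{i\in\mathcal R^c_{\mathrm{priv}}}\ell_i(I),\qquad \widehat{\mathrm{CLS}}{}_q^{(k)}(I)=\max_{i\in\mathcal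 R^c_{\mathrm{priv}}}\max_{\mathbf s\in\mathfrak S^c_k}\sum_{A\subseteq E_i\cap\mathcal R^c_{\mathrm{priv}}}T_{E_i\setminus A}(I)\prod_{j\in A}s_j\quad(k\ge1),$$ $$\mathrm{CRS}_{q,\mathcal A_c}(I)=\max_{k\ge0}e^{-\beta k}\min\{\mathrm{GS}_q,\widehat{\mathrm{CLS}}{}_q^{(k)}(I)\}.$$ If $\mathcal R^c_{\mathrm{priv}}=\emptyset$, then $\mathrm{CLS}_{q,\mathcal A_c}\equiv0$ and $\mathrm{CRS}_{q,\mathcal A_c}\equiv0$. **Release mechanism.** The answer $|q(I)|$ is released with additive noise using the smooth-sensitivity mechanisms of Nissim, Raskhodnikova and Smith: general Cauchy noise (giving $\varepsilon$-contextual DP, i.e. $\delta=0$) or Laplace noise (giving $(\varepsilon,\delta)$-contextual DP), scaled to the smooth upper bound $\mathrm{CRS}_{q,\mathcal A_c}(I)$, with $\beta$ set exactly as when the same mechanisms are calibrated to $\mathrm{RS}_q$.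
   Formalization: Privacy with Laplace noise is stated for ε, δ in (0,1), since it fails for large ε; the foreign-key rule also requires that no legal allowed edit of R_i creates a new boundary value, since a foreign key alone does not make the bound sound. *)

(* Defs.v *)
From HB Require Import structures.
From mathcomp Require Import all_boot all_order all_algebra.
From mathcomp Require Import finmap.
From mathcomp Require Import all_classical all_reals all_analysis.
Set Implicit Arguments.
Unset Strict Implicit.
Unset Printing Implicit Defensive.
Import Order.TTheory GRing.Theory Num.Theory.
Import numFieldNormedType.Exports.

Local Open Scope fmap_scope.
Local Open Scope classical_set_scope.

(* Set semantics.  A tuple over a set X of attributes is a partial assignment
   that is defined exactly on X.  A relation stores its tuples in rows carrying
   an identifier in nat; identifiers take no part in the join, they only give
   every database cell (relation, row, attribute) an address that survives a
   value change in the row. *)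

Record schema := Schema {
  attr : finType;
  value : choiceType;
  dom : attr -> set value;
  nrel : nat;
  vars : 'I_nrel -> {set attr};
  vars_neq0 : forall i, vars i != finset.set0 }.

Notation relid S := 'I_(nrel S).

Definition ptuple (S : schema) : choiceType := {ffun attr S -> option (value S)}.

Definition table (S : schema) := {fmap nat -> ptuple S}.

Definition instance (S : schema) := relid S -> table S.

Section Joins.
Context (S : schema).
Implicit Types (X : {set attr S}) (E : {set relid S}) (i j : relid S).
Implicit Types (D : instance S) (t u b : ptuple S).

(* dom(X) *)
Definition tuples_over X : set (ptuple S) :=
  [set t | forall a, if a \in X then exists2 v, t a = Some v & dom a v
                     else t a = None].

Definition restr X t : ptuple S := [ffun a => if a \in X then t a else None].

Definition has_row D i (r : nat) t : Prop := (D i).[? r] = Some t.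

Definition in_rel D i t : Prop := exists r, has_row D i r t.

Definition attrs_of E : {set attr S} := (\bigcup_(j in E) vars j)%SET.

(* q_E(I) *)
Definition qjoin E D : set (ptuple S) :=
  [set u | tuples_over (attrs_of E) u /\
           forall j, j \in E -> in_rel D j (restr (vars j) u)].

Definition ntuples (A : set (ptuple S)) : nat := (#|` fset_set A|)%fset.

Definition join_size D : nat := ntuples (qjoin [set: relid S]%SET D).

Definition boundary E : {set attr S} := (attrs_of E :&: attrs_of (~: E))%SET.

Definition mult E D b : nat :=
  ntuples [set u | qjoin E D u /\ restr (boundary E) u = b].

End Joins.

(* The maximum of a set of natural numbers, 0 if the set is empty; the minimum,
   x0 if the set is empty. *)
Definition maxset (A : set nat) : nat :=
  xget 0 [set m | A m /\ forall k, A k -> (k <= m)%N].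
Definition minset_dflt (x0 : nat) (A : set nat) : nat :=
  xget x0 [set m | A m /\ forall k, A k -> (m <= k)%N].

Definition T_ (S : schema) (E : {set relid S}) (D : instance S) : nat :=
  maxset [set mult E D b | b in tuples_over (boundary E)].

Definition others (S : schema) (i : relid S) : {set relid S} := (~: [set i])%SET.

Definition bnd (S : schema) (i : relid S) : {set attr S} := boundary (others i).

Definition mu (S : schema) (i : relid S) (D : instance S) (b : ptuple S) : nat :=
  mult (others i) D b.

Inductive edit := Ins | Del | Chg.

(* edits i is the set of the elementary edits that the neighborhood allows on
   relation i: {Ins, Del} for add/remove, {Chg} for change, and any other
   combination. *)
Record setting := Setting {
  base :> schema;
  priv : {set relid base};
  edits : relid base -> set edit;
  integrity : set (instance base) }.

Section Neighbors.
Context (S : setting).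
Implicit Types (D : instance S) (i j : relid S).

Definition legal D : Prop :=
  [/\ forall i r t, has_row D i r t -> tuples_over (vars i) t,
      forall i r r' t, has_row D i r t -> has_row D i r' t -> r = r'
    & integrity D].

Definition edited i (e : edit) D D' : Prop :=
  (forall j, j != i -> D' j = D j) /\
  match e with
  | Ins => exists r t, (D i).[? r] = None /\ D' i = (D i).[r <- t]
  | Del => exists r t, has_row D i r t /\ D' i = (D i).[~ r]
  | Chg => exists r t t',
             [/\ has_row D i r t, t' <> t & D' i = (D i).[r <- t']]
  end.

(* D' is obtained from D by an allowed edit; this is symmetric for the
   add/remove and change neighborhoods and their union. *)
Definition neighbors D D' : Prop :=
  [/\ legal D, legal D' &
      exists i e, [/\ i \in priv S, edits i e & edited i e D D']].

End Neighbors.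

(* The public part of a relation; the two projections are onto the boundary
   attributes of the relation. *)
Inductive pubinfo (S : schema) :=
  | PNone
  | PAll
  | PSel of pred (ptuple S)
  | PPrj
  | PPrjSel of pred (ptuple S).
Arguments PNone {S}.
Arguments PAll {S}.
Arguments PPrj {S}.

Section Context_.
Context (S : setting) (P : relid S -> pubinfo S).
Implicit Types (D : instance S) (i : relid S) (t b : ptuple S).

Definition authorized i t : bool :=
  match P i with
  | PNone => false
  | PAll | PPrj => true
  | PSel phi | PPrjSel phi => phi t
  end.

Definition public_attrs i : {set attr S} :=
  match P i with
  | PNone => finset.set0
  | PAll | PSel _ => vars i
  | PPrj | PPrjSel _ => bnd i
  end.

(* The public cells of D, each with its content. *)
Definition auth_view D : set (relid S * nat * attr S * value S) :=
  [set x | let: (i, r, a, v) := x in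
     exists t, [/\ has_row D i r t, authorized i t, a \in public_attrs i
                 & t a = Some v]].

Definition ctx_neighbors D D' : Prop :=
  neighbors D D' /\ auth_view D = auth_view D'.

Definition occupied D i : set (ptuple S) :=
  [set b | exists2 t, in_rel D i t & b = restr (bnd i) t].

Definition free_bnd D i : set (ptuple S) :=
  [set b | exists t, [/\ in_rel D i t, ~~ authorized i t
                       & b = restr (bnd i) t]].

Definition LS_ i D : nat := T_ (others i) D.

Definition mu_free_1 i D : nat := maxset [set mu i D b | b in free_bnd D i].

(* If no boundary value is free, the minimum is LS_i, the largest possible
   multiplicity. *)
Definition mu_free_min i D : nat :=
  minset_dflt (LS_ i D) [set mu i D b | b in free_bnd D i].

Definition M_unocc i D : nat :=
  maxset [set mu i D b | b in tuples_over (bnd i) `\` occupied D i].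

(* Every legal database has X as a key of relation i. *)
Definition implies_unique i (X : {set attr S}) : Prop :=
  forall D r r' t t', legal D -> has_row D i r t -> has_row D i r' t' ->
    restr X t = restr X t' -> r = r'.

Definition foreign_key i j : Prop :=
  exists (X : {set attr S}) (f : attr S -> attr S),
    [/\ X != finset.set0, X \subset vars i, {in X &, injective f},
        (f @: X)%SET \subset vars j
      & implies_unique j (f @: X)%SET /\
        forall D t, legal D -> in_rel D i t ->
          exists2 u, in_rel D j u & forall a, a \in X -> t a = u (f a)].

Definition no_new_boundary i : Prop :=
  forall D D' e, legal D -> legal D' -> edits i e -> edited i e D D' ->
    occupied D' i `<=` occupied D i.

Definition fk_premise i : Prop :=
  (exists2 j, j != i & foreign_key i j) /\ no_new_boundary i.

(* RSelUniqueFK is Sel-Unique with M_unocc = 0 supplied by the foreign-key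
   rule. *)
Inductive rule :=
  | RBase | RIns | RSelDel | RPrjChg | RPrjSelChg | RSel | RSelUnique
  | RSelUniqueFK | RPub.

(* A rule for a set tau of edits applies when the neighborhood allows no edit
   of relation i outside tau.  The bound of RIns being LS_i, that rule applies
   as soon as insertions are allowed. *)
Definition rule_applies i (rho : rule) : Prop :=
  match rho with
  | RBase => P i = PNone
  | RIns => edits i Ins
  | RSelDel => (exists phi, P i = PSel phi) /\ edits i `<=` [set Del]
  | RPrjChg => P i = PPrj /\ edits i `<=` [set Chg]
  | RPrjSelChg => (exists phi, P i = PPrjSel phi) /\ edits i `<=` [set Chg]
  | RSel => (exists phi, P i = PSel phi) /\ edits i `<=` [set Del; Chg]
  | RSelUnique => (exists phi, P i = PSel phi) /\ implies_unique i (bnd i)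
  | RSelUniqueFK => [/\ exists phi, P i = PSel phi, implies_unique i (bnd i)
                      & fk_premise i]
  | RPub => P i = PAll
  end.

Definition ell i (rho : rule) D : nat :=
  match rho with
  | RBase | RIns => LS_ i D
  | RSelDel => mu_free_1 i D
  | RPrjChg => 0
  | RPrjSelChg | RSel =>
      maxn (T_ (others i) D - mu_free_min i D) (mu_free_1 i D)
  | RSelUnique => maxn (mu_free_1 i D) (M_unocc i D)
  | RSelUniqueFK => maxn (mu_free_1 i D) 0
  | RPub => 0
  end.

Definition is_pub (rho : rule) : bool := if rho is RPub then true else false.

End Context_.

Local Open Scope ring_scope.

Section Sensitivities.
Context (R : realType) (S : setting).
Implicit Types (D : instance S) (i : relid S) (Q : {set relid S}).

Definition size_dist D D' : \bar R := (`|(join_size D)%:R - (join_size D')%:R|)%:E.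

(* The value 0 only matters when there are no neighbors at all. *)
Definition GS : \bar R :=
  ereal_sup ([set 0%E] `|`
    [set x | exists D D', neighbors D D' /\ x = size_dist D D']).

Definition CLS (P : relid S -> pubinfo S) D : \bar R :=
  ereal_sup ([set 0%E] `|`
    [set x | exists2 D', ctx_neighbors P D D' & x = size_dist D D']).

(* Vectors indexed by Q are vectors indexed by all the relations and vanishing
   outside Q; LS_k Q k D takes the maximum over those of total k. *)
Definition LS_k Q (k : nat) D : nat :=
  (\max_(i in Q)
   \max_(s : {ffun relid S -> 'I_k.+1} |
         (\sum_j (s j : nat) == k) && [forall j, (j \notin Q) ==> (s j == 0 :> nat)])
   \sum_(A : {set relid S} | A \subset others i :&: Q)
     T_ (others i :\: A)%SET D * \prod_(j in A) (s j : nat))%N.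

Definition RS (beta : R) D : \bar R :=
  ereal_sup [set ((expR (- beta * k%:R))%:E *
                  Order.min GS ((LS_k (priv S) k D)%:R)%:E)%E | k in [set: nat]].

Variables (P : relid S -> pubinfo S) (rl : relid S -> rule).

Definition cpriv : {set relid S} := [set i in priv S | ~~ is_pub (rl i)]%SET.

Definition CLS_k (k : nat) D : nat :=
  if k is 0 then (\max_(i in cpriv) ell P i (rl i) D)%N else LS_k cpriv k D.

Definition CRS (beta : R) D : \bar R :=
  ereal_sup [set ((expR (- beta * k%:R))%:E *
                  Order.min GS ((CLS_k k D)%:R)%:E)%E | k in [set: nat]].

(* A smooth upper bound is real-valued, hence the finiteness requirement. *)
Definition smooth_upper_bound (beta : R) (Shat : instance S -> \bar R) : Prop :=
  [/\ forall D, legal D -> Shat D \is a fin_num,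
      forall D, legal D -> (CLS P D <= Shat D)%E
    & forall D D', ctx_neighbors P D D' ->
        (Shat D <= (expR beta)%:E * Shat D')%E].

End Sensitivities.

Section Mechanisms.
Context d (Omega : measurableType d) (R : realType).
Variable (Pr : probability Omega R).

Definition contextual_dp (S : setting) (P : relid S -> pubinfo S) (eps delta : R)
    (M : instance S -> {RV Pr >-> R}) : Prop :=
  forall D D', ctx_neighbors P D D' ->
  forall O : set R, measurable O ->
    (Pr (M D @^-1` O) <= (expR eps)%:E * Pr (M D' @^-1` O) + delta%:E)%E.

Definition has_density (Z : {RV Pr >-> R}) (h : R -> R) : Prop :=
  forall O : set R, measurable O ->
    Pr (Z @^-1` O) = (\int[lebesgue_measure]_(x in O) (h x)%:E)%E.

Definition general_cauchy (gamma : R) (Z : {RV Pr >-> R}) : Prop :=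
  exists c : R, has_density Z (fun x => c / (1 + `|x| `^ gamma)).

Definition laplace (Z : {RV Pr >-> R}) : Prop :=
  has_density Z (fun x => expR (- `|x|) / 2).

Section Release.
Variables (S : setting) (Shat : instance S -> \bar R) (alpha : R).
Variables (Z : {RV Pr >-> R}) (D : instance S).

Definition noisy_size (w : Omega) : R :=
  (join_size D)%:R + fine (Shat D) / alpha * Z w.

Lemma measurable_noisy_size : measurable_fun [set: Omega] noisy_size.
Proof.
apply: measurable_realfun.measurable_funD; first exact: measurable_cst.
by apply: measurable_realfun.measurable_funM; [exact: measurable_cst|exact: measurable_funPT].
Qed.

HB.instance Definition _ :=
  isMeasurableFun.Build _ _ _ _ noisy_size measurable_noisy_size.

Definition release : {RV Pr >-> R} := noisy_size.

End Release.

End Mechanisms.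

(* Main.v *)
(* An edit of one row of R_j loses or creates at most one tuple of R_j, so in
   either direction
     T_E(I) <= T_E(I') + T_(E \ j)(I')   (the last term only if j is in E),
   and summing over A shows that the k-th bound at I is at most the (k+1)-st
   bound at I'.  Damping by e^(- beta k) turns this index shift into the factor
   e^beta of smoothness.  A public relation admits no contextual edit, since each
   of its rows has a public cell; for the other rules the join size changes by
   the multiplicity of the boundary value of the edited tuple (or a difference of
   two multiplicities), and preservation of the public cells restricts which
   boundary values can occur.

   For privacy, the two releases on contextual neighbors differ by an affine map
   of the noise, with slope in [e^(- beta), e^beta] and translation controlled by
   the local sensitivity.  By the affine change of variables for the Lebesgue
   measure it suffices to compare densities pointwise, up to an excess
   probability of at most delta in the Laplace case. *)
Require Import Defs.
From HB Require Import structures.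
From mathcomp Require Import all_boot all_order all_algebra.
From mathcomp Require Import finmap zify ring lra.
From mathcomp Require Import all_classical all_reals all_analysis measurable_realfun.
Set Implicit Arguments.
Unset Strict Implicit.
Unset Printing Implicit Defensive.
Import Order.TTheory GRing.Theory Num.Theory.
Import numFieldNormedType.Exports.
Local Open Scope classical_set_scope.

(** * Extrema of sets of natural numbers *)

Section Extrema.
Implicit Types A : set nat.

(** [xget] falls back on 0 unless a maximum exists; a bound and one element provide it. *)
Lemma maxset_attained A M k : (forall n, A n -> n <= M) -> A k ->
  A (Defs.maxset A) /\ forall n, A n -> n <= Defs.maxset A.
Proof.
move=> AM Ak; rewrite /Defs.maxset.
have := @xgetPex _ 0 [set m | A m /\ forall n, A n -> n <= m]; apply.
have exA : exists n, `[< A n >] by exists k; apply/asboolP.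
have leA n : `[< A n >] -> n <= M by move=> /asboolP; exact: AM.
case: (ex_maxnP exA leA) => m /asboolP Am mP; exists m; split=> // n An.
by apply: mP; apply/asboolP.
Qed.

Lemma leq_maxset A M k : (forall n, A n -> n <= M) -> A k -> k <= Defs.maxset A.
Proof. by move=> AM Ak; have [_ ->] := maxset_attained AM Ak. Qed.

Lemma maxset_leq A M : (forall n, A n -> n <= M) -> Defs.maxset A <= M.
Proof.
move=> AM; rewrite /Defs.maxset; case: xgetP => [m _ [Am _]|_]; last exact: leq0n.
exact: AM.
Qed.

Lemma minset_leq x0 A k : A k -> minset_dflt x0 A <= k.
Proof.
move=> Ak; rewrite /minset_dflt.
have exA : exists n, `[< A n >] by exists k; apply/asboolP.
have /(xgetPex x0)[_] : exists m, [set m | A m /\ forall k, A k -> m <= k] m.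
  case: (ex_minnP exA) => m /asboolP Am mP; exists m; split=> // n An.
  by apply: mP; apply/asboolP.
exact.
Qed.

End Extrema.

(** * Cardinalities of sets of tuples *)

Section Counting.
Context (S : schema).
Implicit Types A B C : set (ptuple S).

Lemma leq_ntuples_inj A B (f : ptuple S -> ptuple S) : finite_set B ->
  (forall x y, A x -> A y -> f x = f y -> x = y) ->
  (forall x, A x -> B (f x)) -> ntuples A <= ntuples B.
Proof.
move=> finB f_inj fAB; rewrite /ntuples.
(* [fset_set] sends an infinite set to the empty one, so an infinite [A] counts 0. *)
have [finA|infA] := pselect (finite_set A); last first.
  by rewrite /fset_set; case: pselect.
have <- : #|` [fset f x | x in fset_set A]%fset| = #|` fset_set A|.
  rewrite card_in_imfset// => x y /=.
  by rewrite !in_fset_set// => /set_mem Ax /set_mem Ay; exact: f_inj.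
apply: fsubset_leq_card; apply/fsubsetP => _ /imfsetP[x /= + ->].
by rewrite !in_fset_set// => /set_mem /fAB /mem_set.
Qed.

Lemma leq_ntuples A B : finite_set B -> A `<=` B -> ntuples A <= ntuples B.
Proof. by move=> finB AB; apply: (leq_ntuples_inj (f := id)). Qed.

Lemma leq_ntuplesU A B C : finite_set B -> finite_set C ->
  A `<=` B `|` C -> ntuples A <= ntuples B + ntuples C.
Proof.
move=> finB finC AU; apply: (leq_trans (leq_ntuples _ AU)).
  by rewrite finite_setU.
by rewrite /ntuples fset_setU// cardfsU leq_subr.
Qed.

Lemma ntuplesU A B : finite_set A -> finite_set B -> (forall x, A x -> ~ B x) ->
  ntuples (A `|` B) = ntuples A + ntuples B.
Proof.
move=> finA finB AB; rewrite /ntuples fset_setU// cardfsU.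
rewrite [X in _ - X](_ : _ = 0) ?subn0//; apply/eqP; rewrite cardfs_eq0.
apply/eqP/fsetP => x; rewrite !inE !in_fset_set//.
by apply/negP => /andP[/set_mem /AB ? /set_mem].
Qed.

Lemma ntuples0 : ntuples (set0 : set (ptuple S)) = 0.
Proof. by rewrite /ntuples fset_set0. Qed.

End Counting.

Local Open Scope fmap_scope.

(** * Restriction of tuples, finiteness of joins, boundary multiplicities *)

Section Joins.
Context (S : schema).
Implicit Types (X : {set attr S}) (E : {set relid S}) (i j : relid S).
Implicit Types (D : instance S) (t u b w : ptuple S).

Lemma restrE X t a : restr X t a = if a \in X then t a else None.
Proof. by rewrite ffunE. Qed.

Lemma restr_restr X (Y : {set attr S}) t : X \subset Y ->
  restr X (restr Y t) = restr X t.
Proof.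
move=> XY; apply/ffunP => a; rewrite !restrE.
by case: ifPn => // aX; rewrite (fintype.subsetP XY).
Qed.

Lemma eq_restr X t u : (forall a, a \in X -> t a = u a) -> restr X t = restr X u.
Proof. by move=> tu; apply/ffunP => a; rewrite !restrE; case: ifPn => // /tu. Qed.

Lemma restr_eq X t u a : restr X t = restr X u -> a \in X -> t a = u a.
Proof. by move=> /ffunP/(_ a); rewrite !restrE => + aX; rewrite aX. Qed.

Lemma restr_id X t : tuples_over X t -> restr X t = t.
Proof.
by move=> tX; apply/ffunP => a; rewrite restrE; have := tX a; case: ifPn.
Qed.

Lemma tuples_over_restr X (Y : {set attr S}) t : X \subset Y ->
  tuples_over Y t -> tuples_over X (restr X t).
Proof.
move=> XY tY a; rewrite restrE; case: (boolP (a \in X)) => // aX.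
by have := tY a; rewrite (fintype.subsetP XY).
Qed.

Lemma vars_sub_attrs E j : j \in E -> vars j \subset attrs_of E.
Proof. by move=> jE; rewrite /attrs_of (finset.bigcup_sup j). Qed.

Lemma attrs_of_sub E (F : {set relid S}) : E \subset F ->
  attrs_of E \subset attrs_of F.
Proof.
move=> EF; apply/finset.bigcupsP => j jE; apply: vars_sub_attrs.
exact: (fintype.subsetP EF).
Qed.

(** Domains may be infinite, but every value in a join tuple occurs in one of finitely many rows.
    The join thus lies in the image of the functions from attributes to the finite list [vals]. *)
Lemma finite_qjoin E D : finite_set (qjoin E D).
Proof.
pose rows (j : relid S) : seq (ptuple S) :=
  [seq odflt [ffun=> None] (D j).[? r] | r <- domf (D j)].
pose vals : seq (option (value S)) :=
  flatten [seq flatten [seq codom t | t <- rows j] | j <- enum (relid S)].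
pose F : {ffun attr S -> option (seq_sub vals)} -> ptuple S :=
  fun g => [ffun a => if g a is Some v then val v else None].
apply: (@sub_finite_set _ _ (F @` setT)); last first.
  by apply: finite_image; exact: finite_finset.
move=> u [uE uD].
exists [ffun a => if u a is Some v then insub (u a) else None] => //.
apply/ffunP => a; rewrite !ffunE; case uaE: (u a) => [v|//].
have uav : Some v \in vals.
  have := uE a; case: ifPn => [/finset.bigcupP[j jE aj] _|_]; last by rewrite uaE.
  apply/flatten_mapP; exists j; first by rewrite mem_enum.
  have [r rj] := uD j jE.
  apply/flatten_mapP; exists (restr (vars j) u); last first.
    by apply/codomP; exists a; rewrite restrE aj uaE.
  apply/mapP; exists r; last by rewrite rj.
  by rewrite -fndSome rj.
by rewrite insubT.
Qed.

Lemma leq_mult_join E D b : mult E D b <= ntuples (qjoin E D).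
Proof. by apply: leq_ntuples => [|u []//]; exact: finite_qjoin. Qed.

Lemma leq_mult_T E D b : mult E D b <= T_ E D.
Proof.
have [bE|bE] := pselect (tuples_over (boundary E) b).
  apply: (@leq_maxset _ (ntuples (qjoin E D))); last by exists b.
  by move=> _ [b' _ <-]; exact: leq_mult_join.
(* An assignment that is not over the boundary matches no tuple. *)
rewrite (_ : mult E D b = 0)// /mult (_ : [set u | _] = set0) ?ntuples0//.
rewrite -subset0 => u [[uE _]] /= ub; apply: bE; rewrite -ub.
by apply: tuples_over_restr uE; exact: finset.subsetIl.
Qed.

Lemma T_leq E D m : (forall b, mult E D b <= m) -> T_ E D <= m.
Proof. by move=> Dm; apply: maxset_leq => _ [b _ <-]. Qed.

End Joins.

(** * Effect of one lost tuple on boundary multiplicities *)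

Section Residual.
Context (S : schema).
Implicit Types (E Q : {set relid S}) (i j : relid S).
Implicit Types (D : instance S) (t u b w : ptuple S).

(* One half of an edit: insertions, deletions and value changes are treated at
   once by applying it in both directions. *)
Definition single_loss j D D' : Prop :=
  (forall i, i != j -> D i = D' i) /\
  exists t0, forall t, in_rel D j t -> in_rel D' j t \/ t = t0.

(** Restriction to the attributes of [E :\ j] is injective here, since [t0] fixes those of relation
    [j]. The restricted tuples share one boundary value: a boundary attribute of [E :\ j] belongs to
    relation [j], where [t0] fixes it, or to a relation outside [E], where [b] does. *)
Lemma leq_mult_fixed E j D t0 b : j \in E ->
  ntuples [set u | [/\ qjoin E D u, restr (boundary E) u = b
                     & restr (vars j) u = t0]] <= T_ (E :\ j)%SET D.
Proof.
move=> jE; set C := [set u | _].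
have [[u0 Cu0]|C0] := pselect (exists u, C u); last first.
  rewrite (_ : C = set0) ?ntuples0// -subset0 => u Cu.
  by apply: C0; exists u.
set F := (E :\ j)%SET; set b1 := restr (boundary F) u0.
apply: leq_trans (leq_mult_T F D b1).
have FE : F \subset E by exact: finset.subD1set.
apply: (leq_ntuples_inj (f := restr (attrs_of F))).
- apply: (@sub_finite_set _ _ (qjoin F D)); last exact: finite_qjoin.
  by move=> u [].
- move=> u v [[uE _] _ uj] [[vE _] _ vj] uv; apply/ffunP => a.
  have := uE a; have := vE a; case: ifPn => [|_ -> ->//].
  move=> /finset.bigcupP[k kE ak] _ _; have [kj|kj] := eqVneq k j.
    by apply: (restr_eq (X := vars j)); rewrite ?uj ?vj// -kj.
  have kF : k \in F by rewrite !inE kj.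
  by apply: (restr_eq uv); exact: (fintype.subsetP (vars_sub_attrs kF)).
- move=> u [[uE uD] ub uj]; split; first split.
  + by apply: tuples_over_restr uE; exact: attrs_of_sub.
  + move=> k kF; rewrite restr_restr ?vars_sub_attrs//.
    by apply: uD; exact: (fintype.subsetP FE k kF).
  + rewrite restr_restr ?finset.subsetIl//; apply: eq_restr => a.
    move=> /finset.setIP[aF /finset.bigcupP[k + ak]].
    rewrite !inE negb_and negbK => /orP[]; [move=> /eqP kj|move=> kE].
      case: Cu0 => _ _ u0j.
      by apply: (restr_eq (X := vars j)); rewrite ?uj ?u0j// -kj.
    case: Cu0 => _ u0b _.
    apply: (restr_eq (X := boundary E)); first by rewrite ub u0b.
    rewrite inE (fintype.subsetP (attrs_of_sub FE) a)//=.
    by apply/finset.bigcupP; exists k => //; rewrite inE.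
Qed.

Lemma qjoin_eq E D D' : (forall i, i \in E -> D i = D' i) -> qjoin E D = qjoin E D'.
Proof.
move=> DD'; apply/seteqP; split=> u [uE uD]; split=> // k kE;
  have := uD k kE; rewrite /in_rel /has_row DD'//.
Qed.

Lemma T_eq E D D' : (forall i, i \in E -> D i = D' i) -> T_ E D = T_ E D'.
Proof. by move=> DD'; rewrite /T_ /mult (qjoin_eq DD'). Qed.

(** A tuple of the join at [D] that is missing at [D'] uses the lost tuple [t0] in relation [j].
    [leq_mult_fixed] counts those at [D], and without [j] the joins at [D] and [D'] coincide. *)
Lemma T_single_loss E j D D' : single_loss j D D' ->
  T_ E D <= T_ E D' + (if j \in E then T_ (E :\ j)%SET D' else 0).
Proof.
move=> [DD' [t0 t0P]]; case: ifPn => [jE|jE]; last first.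
  rewrite addn0 (@T_eq E D D') // => i iE; apply: DD'.
  by apply: contraNneq jE => <-.
apply: T_leq => b; pose C := [set u | [/\ qjoin E D u, restr (boundary E) u = b
                     & restr (vars j) u = t0]].
have C_le : ntuples C <= T_ (E :\ j)%SET D'.
  rewrite -(@T_eq _ D); first exact: leq_mult_fixed.
  by move=> i; rewrite !inE => /andP[ij _]; exact: DD'.
apply: leq_trans (leq_add (leq_mult_T E D' b) C_le).
apply: leq_ntuplesU.
- apply: (@sub_finite_set _ _ (qjoin E D')); last exact: finite_qjoin.
  by move=> u [].
- apply: (@sub_finite_set _ _ (qjoin E D)); last exact: finite_qjoin.
  by move=> u [].
move=> u [[uE uD] ub].
have [uj|uj] := t0P _ (uD j jE); last by right.
left; split=> //; split=> // k kE; have [->//|kj] := eqVneq k j.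
by have := uD k kE; rewrite /in_rel /has_row DD'.
Qed.

(* The extra unit of weight on j absorbs the terms [T_ (C :\: A :\ j) D'] that
   the lost tuple contributes, through the bijection [A |-> j |: A]. *)
Lemma leq_residual_sum (C Q : {set relid S}) j (D D' : instance S)
    (s s' : relid S -> nat) : j \in Q -> single_loss j D D' ->
  (forall i, s' i = s i + (i == j)) ->
  \sum_(A : {set relid S} | A \subset (C :&: Q)%SET)
     T_ (C :\: A)%SET D * \prod_(i in A) s i <=
  \sum_(A : {set relid S} | A \subset (C :&: Q)%SET)
     T_ (C :\: A)%SET D' * \prod_(i in A) s' i.
Proof.
move=> jQ DD' s'E.
have prodE A : j \notin A -> \prod_(i in A) s' i = \prod_(i in A) s i.
  move=> jA; apply: eq_bigr => i iA; rewrite s'E.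
  case: eqVneq => [ij|]; last by rewrite addn0.
  by rewrite -ij iA in jA.
have [jC|jC] := boolP (j \in C); last first.
  apply: leq_sum => A AC; rewrite prodE; last first.
    apply: contra jC => /(fintype.subsetP AC); by rewrite inE => /andP[].
  rewrite leq_mul2r; apply/orP; right; have := T_single_loss (C :\: A)%SET DD'.
  by rewrite inE (negbTE jC) andbF addn0.
rewrite [leqLHS](bigID (fun A : {set relid S} => j \notin A))/=.
rewrite [leqRHS](bigID (fun A : {set relid S} => j \notin A))/=.
have T_le (A : {set relid S}) : T_ (C :\: A)%SET D * \prod_(i in A) s i <=
    T_ (C :\: A)%SET D' * \prod_(i in A) s i +
    (if j \in A then 0 else T_ (C :\: (j |: A))%SET D' * \prod_(i in A) s i).
  have := T_single_loss (C :\: A)%SET DD'.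
  rewrite inE jC andbT; case: ifPn => jA TD; last first.
    by rewrite negbK in jA; rewrite jA addn0 leq_mul2r -(addn0 (T_ _ D')) TD orbT.
  rewrite (negbTE jA) -mulnDl leq_mul2r; apply/orP; right; apply: leq_trans TD _.
  by rewrite finset.setDDl finset.setUC.
apply: (@leq_trans (\sum_(A : {set relid S} | (A \subset (C :&: Q)%SET) && (j \notin A))
    (T_ (C :\: A)%SET D' * \prod_(i in A) s' i) +
   (\sum_(A : {set relid S} | (A \subset (C :&: Q)%SET) && (j \notin A))
     T_ (C :\: (j |: A))%SET D' * \prod_(i in A) s i +
   \sum_(A : {set relid S} | (A \subset (C :&: Q)%SET) && ~~ (j \notin A))
     T_ (C :\: A)%SET D' * \prod_(i in A) s i))).
  rewrite addnA -big_split; apply: leq_add; apply: leq_sum => A /andP[AC jA].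
    by apply: leq_trans (T_le A) _; rewrite (negbTE jA) prodE.
  by apply: leq_trans (T_le A) _; rewrite negbK in jA; rewrite jA addn0.
have -> : \sum_(A : {set relid S} | (A \subset (C :&: Q)%SET) && (j \notin A))
     T_ (C :\: (j |: A))%SET D' * \prod_(i in A) s i =
    \sum_(A : {set relid S} | (A \subset (C :&: Q)%SET) && ~~ (j \notin A))
      T_ (C :\: A)%SET D' * \prod_(i in (A :\ j)%SET) s i.
  rewrite [RHS](reindex_onto (fun A => j |: A)%SET (fun A => A :\ j)%SET)/=; last first.
    by move=> A /andP[_]; rewrite negbK => /finset.setD1K.
  apply: eq_big => A; last first.
    by move=> /andP[_ jA]; rewrite finset.setU1K.
  rewrite negbK finset.setU11 andbT finset.subUset finset.sub1set !inE jC jQ /=.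
  congr andb; have [jA|jA] := boolP (j \in A); last by rewrite finset.setU1K ?eqxx.
  by apply/esym/eqP => AE; move: jA; rewrite -AE !inE eqxx.
rewrite leq_add2l -big_split /=; apply: leq_sum => A /andP[_]; rewrite negbK => jA /=.
rewrite -mulnDr leq_mul2l; apply/orP; right.
(* As [s' j = s j + 1], the product of [s'] over [A] is the product of [s] over [A] plus that over
   [A :\ j]. *)
have A_D1 r : \prod_(i in A) r i = r j * \prod_(i in (A :\ j)%SET) r i.
  by rewrite (big_setD1 j jA).
rewrite 2!A_D1 (prodE _ (A :\ j)%SET) ?finset.setD11// s'E eqxx mulnDl mul1n.
by rewrite addnC.
Qed.

End Residual.

(** * Index shift, monotonicity and growth of the residual bounds *)

Section ResidualSensitivity.
Context (S : setting).
Implicit Types (Q : {set relid S}) (i j : relid S) (D : instance S).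

Definition residual_sum Q i (w : relid S -> nat) D : nat :=
  \sum_(A : {set relid S} | A \subset (others i :&: Q)%SET)
     T_ (others i :\: A)%SET D * \prod_(j in A) w j.

Lemma leq_LS_k Q k i D (s : {ffun relid S -> 'I_k.+1}) : i \in Q ->
  \sum_j (s j : nat) = k -> (forall j, j \notin Q -> s j = 0 :> nat) ->
  residual_sum Q i (fun j => s j) D <= LS_k Q k D.
Proof.
move=> iQ /eqP sk s0; apply: leq_trans (leq_bigmax_cond i iQ).
have sQ : (\sum_j (s j : nat) == k) &&
    [forall j, (j \notin Q) ==> (s j == 0 :> nat)].
  by rewrite sk; apply/forallP => j; apply/implyP => /s0 ->.
exact: (@leq_bigmax_cond _ (fun s : {ffun relid S -> 'I_k.+1} =>
    (\sum_j (s j : nat) == k) && [forall j, (j \notin Q) ==> (s j == 0 :> nat)])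
  (fun s => residual_sum Q i (fun j => s j) D) s sQ).
Qed.

(** The lost tuple is paid for by one more change to [j]: adding one to [s] at [j] keeps the support
    in [Q] and raises the total to [k.+1]. *)
Lemma leq_LS_k_step Q j k D D' : j \in Q -> single_loss j D D' ->
  LS_k Q k D <= LS_k Q k.+1 D'.
Proof.
move=> jQ DD'; rewrite {1}/LS_k; apply/bigmax_leqP => i iQ; apply/bigmax_leqP => s.
move=> /andP[/eqP sk /forallP s0].
have s_lt l : s l + (l == j) < k.+2.
  by case: eqVneq => _; rewrite ?addn0 ?addn1 ltnS// ltnW.
pose s' : {ffun relid S -> 'I_k.+2} := [ffun l => Ordinal (s_lt l)].
have s'E l : s' l = s l + (l == j) :> nat by rewrite ffunE.
apply: leq_trans (leq_residual_sum _ jQ DD' s'E) _.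
apply: leq_LS_k => // [|l lQ].
  under eq_bigr do rewrite s'E.
  by rewrite big_split /= sk (bigD1 j)//= eqxx big1 ?addn0 ?addn1// => l /negbTE ->.
rewrite s'E; have := s0 l; rewrite lQ /= => /eqP ->.
by have [lj|//] := eqVneq l j; rewrite lj jQ in lQ.
Qed.

Lemma leq_LS_k_subset Q (Q' : {set relid S}) k D : Q \subset Q' ->
  LS_k Q k D <= LS_k Q' k D.
Proof.
move=> QQ'; rewrite {1}/LS_k; apply/bigmax_leqP => i iQ; apply/bigmax_leqP => s.
move=> /andP[/eqP sk /forallP s0]; have iQ' := fintype.subsetP QQ' i iQ.
apply: leq_trans (leq_LS_k D iQ' sk _); last first.
  move=> l lQ'; apply/eqP; apply: (implyP (s0 l)).
  by apply: contra lQ' => /(fintype.subsetP QQ').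
rewrite /residual_sum.
rewrite [leqRHS](bigID (fun A : {set relid S} => A \subset (others i :&: Q)%SET))/=.
apply: leq_trans (leq_addr _ _).
rewrite [leqRHS](eq_bigl (fun A : {set relid S} => A \subset (others i :&: Q)%SET))//.
move=> A; apply/andb_idl => /fintype.subset_trans; apply.
exact: finset.setIS.
Qed.

Lemma leq_T_LS_k0 Q i D : i \in Q -> T_ (others i) D <= LS_k Q 0 D.
Proof.
move=> iQ; pose s : {ffun relid S -> 'I_1} := [ffun=> ord0].
have s0 j : s j = 0 :> nat by rewrite ffunE.
apply: leq_trans (@leq_LS_k Q 0 i D s iQ _ _) => //; last by rewrite big1.
rewrite /residual_sum (bigD1 finset.set0) ?finset.sub0set//=.
by rewrite finset.setD0 big_set0 muln1 leq_addr.
Qed.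

(** The entries of [s] are at most [k], and each product has at most one factor per relation. This
    growth keeps the damped supremum finite even if [GS] is infinite. *)
Lemma LS_k_polynomial Q D : exists C n, forall k, LS_k Q k D <= C * k.+1 ^ n.
Proof.
exists (\sum_(i : relid S) \sum_(A : {set relid S}) T_ (others i :\: A)%SET D).
exists #|relid S| => k; apply/bigmax_leqP => i iQ; apply/bigmax_leqP => s _.
rewrite (bigD1 i)//= mulnDl; apply: leq_trans (leq_addr _ _).
rewrite big_distrl/=.
rewrite [leqRHS](bigID (fun A : {set relid S} => A \subset (others i :&: Q)%SET))/=.
apply: leq_trans (leq_addr _ _); apply: leq_sum => A _.
rewrite leq_mul2l; apply/orP; right.
apply: (@leq_trans (\prod_(j in A) k.+1)).
  by apply: leq_prod => j _; apply: ltnW; exact: ltn_ord.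
by rewrite prod_nat_const leq_pexp2l// max_card.
Qed.

End ResidualSensitivity.

(** * Effect of an edit on the join size *)

Section Edits.
Context (S : setting).
Implicit Types (i j : relid S) (D : instance S) (t b u : ptuple S) (e : edit).

Lemma attrs_of1 i : attrs_of [set i]%SET = vars i.
Proof. exact: finset.big_set1. Qed.

Lemma bndE i : bnd i = (attrs_of (others i) :&: vars i)%SET.
Proof. by rewrite /bnd /boundary finset.setCK attrs_of1. Qed.

Lemma bnd_sub_vars i : bnd i \subset vars i.
Proof. by rewrite bndE finset.subsetIr. Qed.

Lemma has_row_inj D i r t u : has_row D i r t -> has_row D i r u -> t = u.
Proof. by rewrite /has_row => -> []. Qed.

(** The full join with relation [i] replaced by an arbitrary [K], so that the contribution of a
    single row can be isolated. *)
Definition fiber D i (K : set (ptuple S)) : set (ptuple S) :=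
  [set u | [/\ tuples_over (attrs_of [set: relid S]%SET) u,
               forall j, j != i -> in_rel D j (restr (vars j) u)
             & K (restr (vars i) u)]].

Lemma fiber_join D i (K : set (ptuple S)) : K `<=` in_rel D i ->
  fiber D i K `<=` qjoin [set: relid S]%SET D.
Proof.
move=> KD u [uS uD uK]; split=> // j _.
by have [->|ji] := eqVneq j i; [exact: KD|exact: uD].
Qed.

Lemma join_fiber D i : join_size D = ntuples (fiber D i (in_rel D i)).
Proof.
congr ntuples; apply/seteqP; split; last exact: fiber_join.
by move=> u [uS uD]; split=> // [j _|]; apply: uD; rewrite inE.
Qed.

Lemma fiber_eq D D' i K : (forall j, j != i -> D' j = D j) ->
  fiber D' i K = fiber D i K.
Proof.
move=> DD'; apply/seteqP; split=> u [uS uD uK]; split=> // j ji;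
  have := uD j ji; rewrite /in_rel /has_row DD'//.
Qed.

Lemma mu_eq D D' i b : (forall j, j != i -> D' j = D j) -> mu i D' b = mu i D b.
Proof.
move=> DD'; rewrite /mu /mult (@qjoin_eq _ _ D' D)// => j.
by rewrite !inE; exact: DD'.
Qed.

(** A join tuple through [t] is determined by its part on the other relations; conversely [glue]
    extends any tuple of their join that agrees with [t] on the boundary. The two injections give
    equality. *)
Lemma ntuples_fiber1 D i t : tuples_over (vars i) t -> in_rel D i t ->
  ntuples (fiber D i [set t]) = mu i D (restr (bnd i) t).
Proof.
move=> tV tD; have attrsT a : a \in attrs_of [set: relid S]%SET ->
    a \notin vars i -> a \in attrs_of (others i).
  move=> /finset.bigcupP[k _ ak] ai; apply/finset.bigcupP; exists k => //.
  by rewrite !inE; apply: contraNneq ai => <-.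
have varsT a k : a \in vars k -> a \in attrs_of [set: relid S]%SET.
  by move=> ak; apply/finset.bigcupP; exists k.
apply/eqP; rewrite eqn_leq; apply/andP; split.
  apply: (leq_ntuples_inj (f := restr (attrs_of (others i)))).
  - apply: (@sub_finite_set _ _ (qjoin (others i) D)); last exact: finite_qjoin.
    by move=> u [].
  - move=> u v [uS _ ut] [vS _ vt] uv; apply/ffunP => a.
    have := uS a; have := vS a; case: ifPn => [aT _ _|_ -> ->//].
    have [ai|ai] := boolP (a \in vars i).
      by apply: (restr_eq (X := vars i)); rewrite ?ut ?vt.
    by apply: (restr_eq uv); exact: attrsT.
  - move=> u [uS uD ut]; split; first split.
    + by apply: tuples_over_restr uS; apply: attrs_of_sub; exact: finset.subsetT.
    + move=> k; rewrite !inE => ki; rewrite restr_restr; first exact: uD.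
      by apply: vars_sub_attrs; rewrite !inE.
    + rewrite restr_restr ?finset.subsetIl// -[boundary _]/(bnd i) -ut.
      by rewrite restr_restr// bnd_sub_vars.
pose glue w : ptuple S := [ffun a => if a \in vars i then t a else w a].
apply: (leq_ntuples_inj (f := glue)).
- apply: sub_finite_set (finite_qjoin [set: relid S]%SET D).
  by apply: fiber_join => _ ->.
- move=> u v [[uS _] ub] [[vS _] vb] uv; apply/ffunP => a.
  have := uS a; have := vS a; case: ifPn => [ao _ _|_ -> ->//].
  have [ai|ai] := boolP (a \in vars i).
    apply: (restr_eq (X := bnd i)); last by rewrite bndE inE ao ai.
    by rewrite [LHS]ub.
  by move/ffunP: uv => /(_ a); rewrite !ffunE (negbTE ai).
- move=> w [[wS wD] wb].
  have wt a : a \in bnd i -> w a = t a by exact: (restr_eq wb).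
  have glueE j : j != i -> restr (vars j) (glue w) = restr (vars j) w.
    move=> ji; apply: eq_restr => a aj; rewrite ffunE.
    case: ifPn => // ai; rewrite wt// bndE inE ai andbT.
    by apply/finset.bigcupP; exists j => //; rewrite !inE.
  split.
  + move=> a; rewrite ffunE; have [ai|ai] := boolP (a \in vars i).
      by rewrite (varsT _ i)//; have := tV a; rewrite ai.
    have := wS a; case: ifPn => [ao|ao]; last first.
      move=> ->; case: ifPn => // aT; by rewrite attrsT in ao.
    move: ao => /finset.bigcupP[k _ ak]; by rewrite (varsT _ k).
  + by move=> j ji; rewrite glueE//; apply: wD; rewrite !inE.
  + rewrite /= -(restr_id tV); apply: eq_restr => a ai.
    by rewrite ffunE ai.
Qed.

Lemma join_size_row D i (K : set (ptuple S)) t : tuples_over (vars i) t ->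
  in_rel D i = K `|` [set t] -> ~ K t ->
  join_size D = ntuples (fiber D i K) + mu i D (restr (bnd i) t).
Proof.
move=> tV DE Kt; have tD : in_rel D i t by rewrite DE; right.
have fin K' : K' `<=` in_rel D i -> finite_set (fiber D i K').
  by move=> K'D; apply: sub_finite_set (finite_qjoin [set: relid S]%SET D);
    exact: fiber_join.
rewrite (join_fiber D i) -ntuples_fiber1// -ntuplesU.
- congr ntuples; rewrite DE; apply/seteqP; split=> u.
    by move=> [uS uD [uK|ut]]; [left|right].
  by move=> [] [uS uD uK]; split=> //; [left|right].
- by apply: fin; rewrite DE => x; left.
- by apply: fin => _ ->.
- by move=> u [_ _ uK] [_ _ ut]; apply: Kt; rewrite -ut.
Qed.

(** Legality of [D'] forbids duplicate tuples, so [t] is new to relation [i]. Deletions reuse this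
    with the instances exchanged. *)
Lemma join_size_ins D D' i r t : legal D' -> (forall j, j != i -> D' j = D j) ->
  (D i).[? r] = None -> D' i = (D i).[r <- t] ->
  join_size D' = join_size D + mu i D (restr (bnd i) t).
Proof.
move=> [typ uni _] off Dr D'i.
have rt : has_row D' i r t by rewrite /has_row D'i fnd_set eqxx.
have rows r' u : has_row D i r' u -> has_row D' i r' u.
  rewrite /has_row D'i fnd_set; case: eqVneq => // ->; by rewrite Dr.
rewrite (@join_size_row D' i (in_rel D i) t (typ _ _ _ rt)).
- by rewrite (join_fiber D i) (fiber_eq _ off) (mu_eq _ off).
- apply/seteqP; split=> u; last by case=> [[r' /rows ur']|->]; [exists r'|exists r].
  move=> [r']; rewrite /has_row D'i fnd_set.
  case: eqVneq => [_ [->]|_ ur']; first by right.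
  by left; exists r'.
- move=> [r' tr']; have r'r := uni _ _ _ _ (rows _ _ tr') rt.
  by move: tr'; rewrite /has_row r'r Dr.
Qed.

(** Both joins are split along the rows other than [r], which the instances share. The additive form
    avoids truncated subtraction. *)
Lemma join_size_chg D D' i r t t' : legal D -> legal D' ->
  (forall j, j != i -> D' j = D j) ->
  has_row D i r t -> t' <> t -> D' i = (D i).[r <- t'] ->
  join_size D + mu i D (restr (bnd i) t') = join_size D' + mu i D (restr (bnd i) t).
Proof.
move=> [typ uni _] [typ' uni' _] off rt tt' D'i.
have rt' : has_row D' i r t' by rewrite /has_row D'i fnd_set eqxx.
have rowsE r' u : r' != r -> has_row D' i r' u = has_row D i r' u.
  by move=> r'r; rewrite /has_row D'i fnd_set (negbTE r'r).
pose K : set (ptuple S) := [set u | exists2 r', r' != r & has_row D i r' u].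
rewrite (@join_size_row D i K t (typ _ _ _ rt)).
- rewrite (@join_size_row D' i K t' (typ' _ _ _ rt')).
  + by rewrite (fiber_eq _ off) (mu_eq _ off) addnAC.
  + apply/seteqP; split=> u.
      move=> [r' ur']; have [r'r|r'r] := eqVneq r' r; last first.
        by left; exists r'; rewrite -?rowsE.
      by right; apply: has_row_inj rt'; rewrite -r'r.
    case=> [[r' r'r ur']|->]; last by exists r.
    by exists r'; rewrite rowsE.
  + move=> [r' r'r]; rewrite -rowsE// => tr'.
    by have := uni' _ _ _ _ tr' rt'; apply/eqP.
- apply/seteqP; split=> u.
    move=> [r' ur']; have [r'r|r'r] := eqVneq r' r; last by left; exists r'.
    by right; apply: has_row_inj rt; rewrite -r'r.
  by case=> [[r' r'r ur']|->]; [exists r'|exists r].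
- move=> [r' r'r tr']; by have := uni _ _ _ _ tr' rt; apply/eqP.
Qed.

Lemma del_ins D D' i r t : has_row D i r t -> D' i = (D i).[~ r] ->
  (D' i).[? r] = None /\ D i = (D' i).[r <- t].
Proof.
move=> rt D'i; split; first by rewrite D'i fnd_rem1 eqxx.
apply/fmapP => r'; rewrite D'i fnd_set fnd_rem1.
by case: (eqVneq r' r) => // ->.
Qed.

Lemma edited_single_loss i e D D' : edited i e D D' ->
  single_loss i D D' /\ single_loss i D' D.
Proof.
move=> [off De]; suff [t0 [t1 [DD' D'D]]] : exists t0 t1,
    (forall t, in_rel D i t -> in_rel D' i t \/ t = t0) /\
    (forall t, in_rel D' i t -> in_rel D i t \/ t = t1).
  split; split=> [j ji|]; rewrite ?off//; [by exists t0|by exists t1].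
(* Every edit is an update of one row, a deletion after exchanging the instances. The old content
   [u] is constrained only if the row exists, which covers insertions. *)
have chg (F F' : instance S) r u u' : F' i = (F i).[r <- u'] ->
    (forall v, (F i).[? r] = Some v -> v = u) ->
    (forall t, in_rel F i t -> in_rel F' i t \/ t = u) /\
    (forall t, in_rel F' i t -> in_rel F i t \/ t = u').
  move=> F'i Fu; split=> t [r' tr'].
    have [r'r|r'r] := eqVneq r' r; first by right; apply: Fu; rewrite -r'r.
    by left; exists r'; rewrite /has_row F'i fnd_set (negbTE r'r).
  move: tr'; rewrite /has_row F'i fnd_set.
  case: eqVneq => [_ [->]|_ tr']; first by right.
  by left; exists r'.
case: e De => [[r [t [Dr D'i]]]|[r [t [rt D'i]]]|[r [t [t' [rt _ D'i]]]]].
- by exists t, t; apply: chg D'i _; rewrite Dr.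
- have [D'r Di] := del_ins rt D'i.
  have [] := chg _ _ _ t _ Di; first by rewrite D'r.
  by exists t, t.
- exists t, t'; apply: chg D'i _ => v; rewrite rt; by case.
Qed.

End Edits.

(** * Soundness of the inference rules *)

Section Rules.
Context (S : setting) (P : relid S -> pubinfo S).
Implicit Types (i j : relid S) (D : instance S) (t b u : ptuple S) (e : edit).

Lemma public_attrs_sub i : public_attrs P i \subset vars i.
Proof.
have BV := bnd_sub_vars i.
by rewrite /public_attrs; case: (P i) => //; rewrite finset.sub0set.
Qed.

(** Each public cell of the row reappears in [D'] at the same address, and cells of row [r] all come
    from one tuple. Without a public attribute the row would leave no trace in the view. *)
Lemma auth_row D D' i r t : legal D -> auth_view P D = auth_view P D' ->
  has_row D i r t -> authorized P i t -> public_attrs P i != finset.set0 ->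
  exists t', [/\ has_row D' i r t', authorized P i t' &
                 restr (public_attrs P i) t = restr (public_attrs P i) t'].
Proof.
move=> [typ _ _] DD' rt tA /finset.set0Pn[a0 a0P].
have key a : a \in public_attrs P i -> exists t',
    [/\ has_row D' i r t', authorized P i t' & t a = t' a].
  move=> aP; have := typ _ _ _ rt a.
  rewrite (fintype.subsetP (public_attrs_sub i) a aP) => -[v ta _].
  have : auth_view P D (i, r, a, v) by exists t.
  by rewrite DD' => -[t' [rt' tA' _ ta']]; exists t'; rewrite ta ta'.
have [t' [rt' tA' _]] := key _ a0P; exists t'; split=> //.
apply: eq_restr => a /key[u [ru _ ->]].
by rewrite (has_row_inj ru rt').
Qed.

(** Were [t] authorized, all its cells would be public and row [r] of [D'] would hold [t] again. *)
Lemma edited_row_unauthorized D D' i r t : legal D -> legal D' ->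
  auth_view P D = auth_view P D' -> public_attrs P i = vars i ->
  has_row D i r t -> ~ has_row D' i r t -> ~~ authorized P i t.
Proof.
move=> lD [typ' _ _] DD' pV rt Nrt; apply/negP => tA.
have [|t' [rt' _ tt']] := auth_row lD DD' rt tA; first by rewrite pV vars_neq0.
apply: Nrt; have [typ _ _] := lD.
move: tt'; rewrite pV (restr_id (typ _ _ _ rt)) (restr_id (typ' _ _ _ rt')).
by move=> ->.
Qed.

Lemma mu_le_free1 i D b : free_bnd P D i b -> mu i D b <= mu_free_1 P i D.
Proof.
move=> bF; apply: (@leq_maxset _ (LS_ i D)); last by exists b.
by move=> _ [b' _ <-]; exact: leq_mult_T.
Qed.

Lemma mu_free_min_le i D b : free_bnd P D i b -> mu_free_min P i D <= mu i D b.
Proof. by move=> bF; apply: minset_leq; exists b. Qed.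

Lemma mu_le_unocc i D b : tuples_over (bnd i) b -> ~ occupied D i b ->
  mu i D b <= M_unocc i D.
Proof.
move=> bB bN; apply: (@leq_maxset _ (LS_ i D)); last by exists b.
by move=> _ [b' _ <-]; exact: leq_mult_T.
Qed.

Lemma mu_free1_le_LS i D : mu_free_1 P i D <= LS_ i D.
Proof. by apply: maxset_leq => _ [b _ <-]; exact: leq_mult_T. Qed.

Lemma ell_le_LS i rho D : ell P i rho D <= LS_ i D.
Proof.
have F1 := mu_free1_le_LS i D.
by case: rho => //=; rewrite geq_max ?F1 ?leq_subr ?andbT//=;
  apply: maxset_leq => _ [b _ <-]; exact: leq_mult_T.
Qed.

Definition differ_by_at_most m n l := m <= n + l /\ n <= m + l.

(** The join-size formulas reduce each case to bounding the multiplicities of the old and new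
    boundary values of the edited row; the premise of the rule and the equality of views restrict
    these values or exclude the edit. *)
Lemma rule_sound D D' i e rho : legal D -> legal D' -> edits i e ->
  edited i e D D' -> auth_view P D = auth_view P D' -> rule_applies P i rho ->
  ~~ is_pub rho /\ differ_by_at_most (join_size D) (join_size D') (ell P i rho D).
Proof.
move=> lD lD' ie [off De] DD' rhoP.
have [typ uni _] := lD; have [typ' uni' _] := lD'.
have LSle b : mu i D b <= LS_ i D by exact: leq_mult_T.
have tB F r t (lF : legal F) : has_row F i r t -> tuples_over (bnd i) (restr (bnd i) t).
  by have [typF _ _] := lF => /typF; apply: tuples_over_restr; exact: bnd_sub_vars.
have free r t : has_row D i r t -> ~~ authorized P i t ->
    mu i D (restr (bnd i) t) <= mu_free_1 P i D /\
    mu_free_min P i D <= mu i D (restr (bnd i) t).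
  by move=> rt tA; split; [apply: mu_le_free1|apply: mu_free_min_le];
    exists t; split=> //; exists r.
have unauth := edited_row_unauthorized lD lD' DD'.
have unauth' := edited_row_unauthorized lD' lD (esym DD').
case: e ie De => ie De.
- have [r [t [Dr D'i]]] := De.
  have rt : has_row D' i r t by rewrite /has_row D'i fnd_set eqxx.
  have NDrt : ~ has_row D i r t by rewrite /has_row Dr.
  have other r' u : has_row D i r' u -> has_row D' i r' u /\ r' != r.
    by rewrite /has_row D'i fnd_set; case: eqVneq => // ->; rewrite Dr.
  have diff := join_size_ins lD' off Dr D'i.
  suff [Nrho le_ell] : ~~ is_pub rho /\ mu i D (restr (bnd i) t) <= ell P i rho D.
    by split=> //; rewrite /differ_by_at_most diff; split; lia.
  (* The row occupying this boundary value in [D] would survive in [D'] next to the inserted one. *)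
  have new : implies_unique i (bnd i) -> ~ occupied D i (restr (bnd i) t).
    move=> uniB [u [r' ur'] tu]; have [ur'D' /eqP] := other _ _ ur'.
    by apply; apply: uniB lD' ur'D' rt _.
  case: rho rhoP => //=.
  + by move=> [_ /(_ _ ie)].
  + by move=> [_ /(_ _ ie)].
  + by move=> [_ /(_ _ ie)].
  + by move=> [_ /(_ _ ie)] [].
  + move=> [_ uniB]; split=> //; rewrite leq_max mu_le_unocc ?orbT//.
      exact: tB rt.
    exact: new.
  (* The insertion would create a new boundary value, against the foreign key. *)
  + move=> [_ uniB [_ nnb]]; case: (new uniB).
    apply: (nnb _ _ _ lD lD' ie); first by split.
    by exists t => //; exists r.
  + move=> Pi; have /unauth' /(_ rt NDrt) : public_attrs P i = vars i.
      by rewrite /public_attrs Pi.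
    by rewrite /authorized Pi.
- have [r [t [rt D'i]]] := De.
  have [D'r Di] := del_ins rt D'i.
  have NDrt : ~ has_row D' i r t by rewrite /has_row D'r.
  have off' j : j != i -> D j = D' j by move=> /off ->.
  have diff := join_size_ins lD off' D'r Di; rewrite (mu_eq _ off) in diff.
  suff [Nrho le_ell] : ~~ is_pub rho /\ mu i D (restr (bnd i) t) <= ell P i rho D.
    by split=> //; rewrite /differ_by_at_most diff; split; lia.
  have sel phi : P i = PSel phi -> mu i D (restr (bnd i) t) <= mu_free_1 P i D.
    move=> Pi; have /unauth /(_ rt NDrt) : public_attrs P i = vars i.
      by rewrite /public_attrs Pi.
    by move=> /(free _ _ rt)[].
  case: rho rhoP => //=.
  + by move=> [[phi /sel]].
  + by move=> [_ /(_ _ ie)].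
  + by move=> [_ /(_ _ ie)].
  + by move=> [[phi /sel le1] _]; rewrite leq_max le1 orbT.
  + by move=> [[phi /sel le1] _]; rewrite leq_max le1.
  + by move=> [[phi /sel le1] _]; rewrite leq_max le1.
  + move=> Pi; have /unauth /(_ rt NDrt) : public_attrs P i = vars i.
      by rewrite /public_attrs Pi.
    by rewrite /authorized Pi.
- have [r [t [t' [rt tt' D'i]]]] := De.
  have rt' : has_row D' i r t' by rewrite /has_row D'i fnd_set eqxx.
  have NDrt : ~ has_row D' i r t by move=> /has_row_inj /(_ rt') t't; apply: tt'.
  have other r' u : has_row D i r' u -> r' != r -> has_row D' i r' u.
    by move=> ur' r'r; rewrite /has_row D'i fnd_set (negbTE r'r).
  have diff := join_size_chg lD lD' off rt tt' D'i.
  set m := mu i D (restr (bnd i) t) in diff; set m' := mu i D _ in diff.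
  suff [Nrho [le_ell le_ell']] : ~~ is_pub rho /\
      (m <= m' + ell P i rho D /\ m' <= m + ell P i rho D).
    by split=> //; rewrite /differ_by_at_most; split; lia.
  have mT : m <= T_ (others i) D by exact: LSle.
  have m'T : m' <= T_ (others i) D by exact: LSle.
  have sel phi : P i = PSel phi -> m <= mu_free_1 P i D /\ mu_free_min P i D <= m.
    move=> Pi; have /unauth /(_ rt NDrt) : public_attrs P i = vars i.
      by rewrite /public_attrs Pi.
    by move=> /(free _ _ rt).
  have same : restr (bnd i) t = restr (bnd i) t' -> m = m' by rewrite /m /m' => ->.
  (* Another row of [D] with the new boundary value would clash with row [r] in [D']; if row [r]
     itself had it, the boundary value has not changed. *)
  have occ : implies_unique i (bnd i) -> m = m' \/ ~ occupied D i (restr (bnd i) t').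
    move=> uniB; have [|] := pselect (occupied D i (restr (bnd i) t')); last by right.
    move=> [u [r' ur'] t'u]; left; have [r'r|r'r] := eqVneq r' r.
      by apply: same; rewrite t'u; congr restr; apply: has_row_inj rt _; rewrite -r'r.
    have /eqP := uniB _ _ _ _ _ lD' (other _ _ ur' r'r) rt' (esym t'u).
    by rewrite (negbTE r'r).
  have bnd0 : bnd i = finset.set0 -> m = m'.
    by move=> B0; apply: same; apply: eq_restr => a; rewrite B0 inE.
  case: rho rhoP => /=.
  + by move=> _; rewrite /LS_; lia.
  + by move=> _; rewrite /LS_; lia.
  + by move=> [_ /(_ _ ie)].
  + move=> [Pi _]; split=> //; suff -> : m = m' by lia.
    have [/bnd0//|B0] := eqVneq (bnd i) finset.set0; apply: same.
    have [||u [ru _]] := auth_row lD DD' rt; rewrite /authorized /public_attrs ?Pi//.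
    by rewrite (has_row_inj ru rt').
  (* An authorized row keeps its boundary value; for an unauthorized one, [m] lies between the free
     minimum and the free maximum, while [m'] is at most [T_]. *)
  + move=> [[phi Pi] _]; split=> //.
    have [/bnd0 -> |B0] := eqVneq (bnd i) finset.set0; first by lia.
    have [tA|/(free _ _ rt)] := boolP (authorized P i t); last first.
      by move=> []; rewrite -/m => m1 m2; lia.
    have [||u [ru _]] := auth_row lD DD' rt; rewrite /authorized /public_attrs ?Pi//.
      by move: tA; rewrite /authorized Pi.
    by rewrite (has_row_inj ru rt') => /same ->; lia.
  + by move=> [[phi /sel[m1 m2]] _]; split=> //; lia.
  + move=> [[phi /sel[m1 m2]] uniB]; split=> //.
    have [->|/mu_le_unocc] := occ uniB; first by lia.
    move=> /(_ (tB _ _ _ lD' rt')); rewrite -/m'; lia.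
  + move=> [_ uniB [_ nnb]]; split=> //; have [->|[]] := occ uniB; first by lia.
    by apply: (nnb _ _ _ lD lD' ie); [split|exists t' => //; exists r].
  + move=> Pi; have /unauth /(_ rt NDrt) : public_attrs P i = vars i.
      by rewrite /public_attrs Pi.
    by rewrite /authorized Pi.
Qed.

End Rules.

Local Open Scope ring_scope.

(** * Exponentially damped suprema *)

Section DampedSupremum.
Context (R : realType) (G : \bar R) (beta : R).
Hypotheses (G0 : (0 <= G)%E) (beta0 : 0 < beta).
Implicit Types f g : nat -> nat.

Definition damped f (k : nat) : \bar R :=
  ((expR (- beta * k%:R))%:E * Order.min G ((f k)%:R)%:E)%E.

Definition damped_sup f : \bar R := ereal_sup [set damped f k | k in [set: nat]].

Lemma damped_le f k : (damped f k <= damped_sup f)%E.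
Proof. by apply: ereal_sup_ubound; exists k. Qed.

Lemma damped_ge0 f k : (0 <= damped f k)%E.
Proof. by rewrite mule_ge0// ?lee_fin ?expR_ge0// le_min G0 lee_fin ler0n. Qed.

Lemma damped_sup_ge0 f : (0 <= damped_sup f)%E.
Proof. exact: le_trans (damped_ge0 f 0) (damped_le f 0). Qed.

Lemma min_le_damped_sup f : (Order.min G ((f 0)%:R)%:E <= damped_sup f)%E.
Proof.
by have := damped_le f 0; rewrite /damped mulr0 expR0 mul1e.
Qed.

Lemma min_natr_le (m n : nat) : (m <= n)%N ->
  (Order.min G (m%:R)%:E <= Order.min G (n%:R)%:E)%E.
Proof.
by move=> mn; apply: le_min2 => //; rewrite lee_fin ler_nat.
Qed.

Lemma damped_sup_le f g : (forall k, f k <= g k)%N -> (damped_sup f <= damped_sup g)%E.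
Proof.
move=> fg; apply: ge_ereal_sup => _ [k _ <-]; apply: le_trans (damped_le g k).
by apply: lee_wpmul2l; [rewrite lee_fin expR_ge0|exact: min_natr_le].
Qed.

(** The damping factor at [k] is [expR beta] times the one at [k.+1], so term [k] of [f] is compared
    with term [k.+1] of [g]. *)
Lemma damped_sup_shift f g : (forall k, f k <= g k.+1)%N ->
  (damped_sup f <= (expR beta)%:E * damped_sup g)%E.
Proof.
move=> fg; apply: ge_ereal_sup => _ [k _ <-].
apply: (@le_trans _ _ ((expR beta)%:E * damped g k.+1)%E); last first.
  by apply: lee_wpmul2l; [rewrite lee_fin expR_ge0|exact: damped_le].
rewrite /damped muleA -EFinM -expRD -natr1 mulrDr mulr1.
rewrite addrCA subrr addr0.
by apply: lee_wpmul2l; [rewrite lee_fin expR_ge0|exact: min_natr_le].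
Qed.

(** With [c] the larger of 1 and [n / beta], [k + 1 <= c * (1 + beta * k / n) <= c * expR (beta * k
    / n)]; take [n]-th powers. *)
Lemma expR_nat_pow_bound n :
  exists2 B : R, 0 < B & forall k, expR (- beta * k%:R) * (k.+1 ^ n)%:R <= B.
Proof.
pose c := Num.max 1 (n%:R / beta); have c1 : 1 <= c by rewrite le_max lexx.
have c0 : 0 < c by exact: lt_le_trans ltr01 c1.
exists (c ^+ n) => [|k]; first exact: exprn_gt0.
have [->|n0] := eqVneq n 0%N.
  rewrite expr0 expn0 mulr1 -[X in _ <= X](expR0 R) ler_expR mulNr oppr_le0.
  by rewrite mulr_ge0// ltW.
have nR : 0 < n%:R :> R by rewrite ltr0n lt0n.
rewrite mulrC -ler_pdivlMr ?expR_gt0// -expRN mulNr opprK.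
have -> : beta * k%:R = (beta * k%:R / n%:R) * n%:R.
  by rewrite divfK// gt_eqF.
rewrite expRM_natr -exprMn natrX; apply: lerXn2r; rewrite ?nnegrE ?ler0n//.
  by rewrite mulr_ge0 ?expR_ge0// ltW.
apply: le_trans (_ : c * (1 + beta * k%:R / n%:R) <= _); last first.
  by rewrite ler_pM2l// expR_ge1Dx.
rewrite mulrDr mulr1 -natr1 addrC lerD//.
have : n%:R / beta <= c by rewrite le_max lexx orbT.
rewrite ler_pdivrMr// => nc.
rewrite !mulrA ler_pdivlMr// mulrC; rewrite ler_wpM2r//.
Qed.

Lemma damped_sup_fin f C n : (forall k, f k <= C * k.+1 ^ n)%N ->
  damped_sup f \is a fin_num.
Proof.
move=> fC; have [B B0 BP] := expR_nat_pow_bound n.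
rewrite ge0_fin_numE ?damped_sup_ge0//.
apply: (@le_lt_trans _ _ (C%:R * B)%:E); last exact: ltry.
apply: ge_ereal_sup => _ [k _ <-].
apply: (@le_trans _ _ ((expR (- beta * k%:R))%:E * (C%:R * (k.+1 ^ n)%:R)%:E)%E).
  apply: lee_wpmul2l; first by rewrite lee_fin expR_ge0.
  by rewrite ge_min lee_fin -natrM ler_nat fC orbT.
by rewrite -EFinM lee_fin mulrCA ler_wpM2l.
Qed.

End DampedSupremum.

(** * Smoothness of the contextual residual sensitivity and comparison with the residual one *)

Section Smoothness.
Context (R : realType) (S : setting) (P : relid S -> pubinfo S).
Context (rl : relid S -> rule) (beta : R).
Hypothesis rlP : forall i, i \in priv S -> rule_applies P i (rl i).
Hypothesis beta0 : 0 < beta.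
Implicit Types D : instance S.

Let cpriv := cpriv rl.

Lemma GS_ge0 : (0 <= GS R S)%E.
Proof. by apply: ereal_sup_ubound; left. Qed.

Lemma cpriv_sub : cpriv \subset priv S.
Proof. by apply/fintype.subsetP => i; rewrite inE => /andP[]. Qed.

Lemma CLS_k_le_LS_k k D : (CLS_k P rl k D <= LS_k cpriv k D)%N.
Proof.
case: k => [|//]; apply/bigmax_leqP => i iQ.
exact: leq_trans (ell_le_LS _ _ _ _) (leq_T_LS_k0 _ iQ).
Qed.

(** The right-hand index is positive, where [CLS_k] is a residual bound; the values [ell] at [D']
    never enter, and those at [D] only need an upper bound. *)
Lemma CLS_k_step j k D D' : j \in cpriv -> single_loss j D D' ->
  (CLS_k P rl k D <= CLS_k P rl k.+1 D')%N.
Proof.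
by move=> jQ DD'; apply: leq_trans (CLS_k_le_LS_k _ _) (leq_LS_k_step _ jQ DD').
Qed.

Lemma ctx_neighborsP D D' : ctx_neighbors P D D' ->
  exists2 j, j \in cpriv &
    [/\ single_loss j D D', single_loss j D' D &
        differ_by_at_most (join_size D) (join_size D') (ell P j (rl j) D)].
Proof.
move=> [[lD lD' [i [e [iS ie De]]]] DD'].
have [Npub distD] := rule_sound lD lD' ie De DD' (rlP iS).
have [DlD' D'lD] := edited_single_loss De.
by exists i => //; rewrite inE iS.
Qed.

Lemma CRSE D : CRS P rl beta D = damped_sup (GS R S) beta (fun k => CLS_k P rl k D).
Proof. by []. Qed.

Lemma CRS_ge0 D : (0 <= CRS P rl beta D)%E.
Proof. exact/damped_sup_ge0/GS_ge0. Qed.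

Lemma CRS_fin D : CRS P rl beta D \is a fin_num.
Proof.
have [C [n LSC]] := LS_k_polynomial cpriv D.
rewrite CRSE; apply: (damped_sup_fin GS_ge0 beta0) => k.
exact: leq_trans (CLS_k_le_LS_k _ _) (LSC k).
Qed.

Lemma CRS_le_RS D : (CRS P rl beta D <= RS beta D)%E.
Proof.
apply: (@damped_sup_le _ (GS R S) beta _ (LS_k (priv S) ^~ D)) => k.
exact: leq_trans (CLS_k_le_LS_k _ _) (leq_LS_k_subset _ _ cpriv_sub).
Qed.

Lemma CRS_step j D D' : j \in cpriv -> single_loss j D D' ->
  (CRS P rl beta D <= (expR beta)%:E * CRS P rl beta D')%E.
Proof. by move=> jQ DD'; apply: damped_sup_shift => k; exact: CLS_k_step jQ DD'. Qed.

(* The neighborhood need not be symmetric (edits may be deletions only), yet the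
   noise calibration needs both inequalities. *)
Lemma CRS_smooth D D' : ctx_neighbors P D D' ->
  (CRS P rl beta D <= (expR beta)%:E * CRS P rl beta D')%E /\
  (CRS P rl beta D' <= (expR beta)%:E * CRS P rl beta D)%E.
Proof.
by move=> /ctx_neighborsP[j jQ [DD' D'D _]]; split; exact: CRS_step jQ _.
Qed.

(** The undamped term [k = 0] suffices: [GS] and the bound [ell] of the edited relation both
    dominate the change. *)
Lemma size_dist_le_CRS D D' : ctx_neighbors P D D' ->
  (size_dist R D D' <= CRS P rl beta D)%E.
Proof.
move=> DD'; have [j jQ [_ _ [le1 le2]]] := ctx_neighborsP DD'.
apply: le_trans (min_le_damped_sup (GS R S) beta (fun k => CLS_k P rl k D)).
rewrite le_min; apply/andP; split.
  by apply: ereal_sup_ubound; right; exists D, D'; split=> //; case: DD'.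
apply: (@le_trans _ _ (((ell P j (rl j) D)%:R)%:E)); last first.
  by rewrite lee_fin ler_nat /=; exact: (leq_bigmax_cond j jQ).
by rewrite lee_fin ler_distl lerBlDr -!natrD !ler_nat le1 le2.
Qed.

Lemma CLS_le_CRS D : (CLS R P D <= CRS P rl beta D)%E.
Proof.
apply: ge_ereal_sup => _ [->|[D' DD' ->]]; first exact: CRS_ge0.
exact: size_dist_le_CRS.
Qed.

End Smoothness.

(** * Affine change of variables for densities *)

Section AffineDensity.
Context (R : realType).
Implicit Types (a b x : R).

Definition affine a b (x : measurableTypeR R) : measurableTypeR R := a * (x : R) + b.

Lemma measurable_affine a b : measurable_fun [set: measurableTypeR R] (affine a b).
Proof.
apply: measurable_funD; last exact: measurable_cst.
by apply: measurable_funM; [exact: measurable_cst|exact: measurable_id].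
Qed.

(** Named so as to receive its own measure structure, which scaling by [a] then builds on. *)
Definition affine_image a b : set (measurableTypeR R) -> \bar R :=
  pushforward lebesgue_measure (affine a b).

Let affine_image0 a b : affine_image a b set0 = 0%E.
Proof. by have mf := measurable_affine a b; exact: measure0. Qed.

Let affine_image_ge0 a b A : (0 <= affine_image a b A)%E.
Proof. by have mf := measurable_affine a b; exact: measure_ge0. Qed.

Let affine_image_sigma_additive a b : semi_sigma_additive (affine_image a b).
Proof. by have mf := measurable_affine a b; exact: measure_semi_sigma_additive. Qed.

HB.instance Definition _ a b := isMeasure.Build _ _ _ (affine_image a b)
  (affine_image0 a b) (@affine_image_ge0 a b) (@affine_image_sigma_additive a b).

(** By uniqueness of Lebesgue measure, half-open intervals suffice, and their preimages are shorter
    by the factor [a]. *)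
Lemma lebesgue_affine a b (a0 : 0 < a) (A : set R) : measurable A ->
  mscale (NngNum (ltW a0)) (affine_image a b) A = lebesgue_measure A.
Proof.
move=> mA; apply/esym/lebesgue_measure_unique => //= _ [[u v]] _ <- /=.
rewrite /mscale /= /affine_image /pushforward.
have -> : affine a b @^-1` `]u, v]%classic = `](u - b) / a, (v - b) / a]%classic.
  apply/seteqP; split=> x /=; rewrite !in_itv/= /affine;
  by rewrite ltr_pdivrMr// ler_pdivlMr// ltrBlDr lerBrDr mulrC.
rewrite !lebesgue_measure_itv/= !lte_fin ltr_pM2r ?invr_gt0// ltrD2r.
case: ifPn => _; last by rewrite mule0.
rewrite -!EFinD -EFinM; congr EFin; field.
by rewrite gt_eqF.
Qed.

Context d (Omega : measurableType d) (Pr : probability Omega R).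
Context (Z : {RV Pr >-> R}) (h : R -> R).
Hypotheses (h0 : forall x, 0 <= h x) (mh : measurable_fun [set: R] h).
Hypothesis Zh : has_density Z h.

(** The substitution [y = a * x + b] moves the integral over [O] to its preimage, where the
    integrands compare pointwise. The set [A] allows a tail to be discarded where the comparison
    fails. *)
Lemma density_affine_le a b K (A O : set R) : 0 < a -> 0 <= K ->
  measurable A -> measurable O ->
  (forall x, A x -> h x <= K * (a * h (a * x + b))) ->
  (Pr (Z @^-1` (A `&` affine a b @^-1` O)) <= K%:E * Pr (Z @^-1` O))%E.
Proof.
move=> a0 K0 mA mO hA.
have mO' : measurable (affine a b @^-1` O).
  by rewrite -[X in measurable X]setTI; exact: measurable_affine.
have mha : measurable_fun [set: measurableTypeR R] (EFin \o (h \o affine a b)).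
  apply/measurable_EFinP; apply: (measurableT_comp mh).
  exact: measurable_affine.
rewrite !Zh//; last exact: measurableI.
have -> : (\int[lebesgue_measure]_(x in O) (h x)%:E =
    a%:E * \int[lebesgue_measure]_(x in affine a b @^-1` O) (h (affine a b x))%:E)%E.
  transitivity (\int[mscale (NngNum (ltW a0)) (affine_image a b)]_(x in O) (h x)%:E)%E.
    by apply: eq_measure_integral => B mB _; apply/esym/lebesgue_affine.
  rewrite ge0_integral_mscale//=; last 2 first.
    exact/measurable_EFinP/(measurable_funS measurableT).
    by move=> x _; rewrite lee_fin.
  rewrite ge0_integral_pushforward//=.
  - exact: measurable_affine.
  - exact/measurable_EFinP/(measurable_funS measurableT).
  - by move=> x _; rewrite lee_fin.
rewrite muleA -EFinM -ge0_integralZl_EFin//; last 3 first.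
- by move=> x _; rewrite lee_fin.
- exact: measurable_funS mha.
- by rewrite mulr_ge0// ltW.
apply: (@le_trans _ _ (\int[lebesgue_measure]_(x in A `&` affine a b @^-1` O)
    ((K * a)%:E * (h (affine a b x))%:E))%E).
  apply: ge0_le_integral => //.
  - exact: measurableI.
  - by move=> x _; rewrite lee_fin.
  - exact/measurable_EFinP/(measurable_funS measurableT).
  - apply: measurable_funeM; exact: measurable_funS mha.
  - by move=> x [Ax _]; rewrite -EFinM lee_fin -mulrA; exact: hA.
apply: ge0_subset_integral => //.
- exact: measurableI.
- by apply: measurable_funeM; exact: measurable_funS mha.
- by move=> x _; rewrite -EFinM lee_fin mulr_ge0// mulr_ge0// ltW.
Qed.

End AffineDensity.

(** * From robust noise to contextual privacy *)

Section Admissible.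
Context (R : realType) d (Omega : measurableType d) (Pr : probability Omega R).
Implicit Types (Z : {RV Pr >-> R}) (alpha beta eps delta : R).

(* Robustness of the noise under a dilation by at most [expR beta] combined with
   a translation by at most [alpha] (measured in the noise scale). *)
Definition admissible Z alpha beta eps delta : Prop :=
  forall a b, expR (- beta) <= a <= expR beta -> `|b| <= alpha * a ->
  forall O : set R, measurable O ->
    (Pr (Z @^-1` (affine a b @^-1` O)) <=
     (expR eps)%:E * Pr (Z @^-1` O) + delta%:E)%E.

Lemma measurable_preimage_affine a b (O : set R) : measurable O ->
  measurable (affine a b @^-1` O : set R).
Proof.
by move=> mO; rewrite -[X in measurable X]setTI; exact: measurable_affine.
Qed.

Lemma measurable_preimage_RV Z (O : set R) : measurable O -> measurable (Z @^-1` O).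
Proof. by move=> mO; exact: measurable_funPTI. Qed.

(** Smoothness in both directions bounds the ratio of the two noise scales, and the bound on
    [size_dist] controls the translation. *)
Lemma admissible_release (S : setting) (P : relid S -> pubinfo S)
    (Shat : instance S -> \bar R) Z alpha beta eps delta :
  0 < alpha -> 0 <= eps -> 0 <= delta ->
  (forall D, Shat D \is a fin_num) -> (forall D, 0 <= Shat D)%E ->
  (forall D D', ctx_neighbors P D D' ->
     [/\ (Shat D <= (expR beta)%:E * Shat D')%E,
         (Shat D' <= (expR beta)%:E * Shat D)%E
       & (size_dist R D D' <= Shat D)%E]) ->
  admissible Z alpha beta eps delta ->
  contextual_dp P eps delta (release Shat alpha Z).
Proof.
move=> alpha0 eps0 delta0 Sfin S0 smooth adm D D' DD' O mO.
have preE F : release Shat alpha Z F @^-1` O =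
    Z @^-1` (affine (fine (Shat F) / alpha) (join_size F)%:R @^-1` O).
  by apply/seteqP; split=> w /=; rewrite /noisy_size /affine addrC.
have [] := smooth _ _ DD'; rewrite /size_dist.
have := S0 D; have := S0 D'; have := Sfin D; have := Sfin D'; rewrite !preE.
case: (Shat D) => [s| |]//; case: (Shat D') => [s'| |]// _ _.
rewrite !lee_fin /= => s'0 s0 ss' s's fs.
set f := _%:R in fs *; set f' := _%:R in fs *.
(* At scale zero the counts agree and the other scale vanishes too, so both releases are the same
   constant. *)
have [s_eq0|s_neq0] := eqVneq s 0.
  have f_eq : f = f' by apply/eqP; rewrite -subr_eq0 -normr_le0 -s_eq0.
  have -> : s' = s.
    by apply/eqP; rewrite s_eq0 eq_le s'0 andbT (le_trans s's)// s_eq0 mulr0.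
  rewrite -f_eq; apply: (@le_trans _ _ ((expR eps)%:E *
      Pr (Z @^-1` (affine (s / alpha) f @^-1` O)))%E).
    rewrite -{1}[Pr _]mul1e; apply: lee_wpmul2r => //.
    by rewrite lee_fin -expR0 ler_expR.
  by rewrite leeDl// lee_fin.
have sp : 0 < s by rewrite lt0r s_neq0.
have s'p : 0 < s'.
  rewrite lt0r s'0 andbT; apply: contraTneq ss' => ->.
  by rewrite mulr0 -ltNge.
(* As [|f - f'| <= s], the translation is at most [alpha] times the slope [s / s']. *)
have -> : affine (s / alpha) f @^-1` O =
    affine (s / s') ((f - f') / (s' / alpha)) @^-1` (affine (s' / alpha) f' @^-1` O).
  apply/seteqP; split=> x /=; rewrite /affine; congr O; field;
  by rewrite ?gt_eqF//= gt_eqF.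
apply: adm; last exact: measurable_preimage_affine.
  rewrite ler_pdivrMr// ss' andbT ler_pdivlMr// expRN.
  by rewrite mulrC ler_pdivrMr ?expR_gt0// mulrC.
rewrite normrM normfV (gtr0_norm (divr_gt0 s'p alpha0)).
rewrite invf_div mulrCA ler_pM2l// ler_pM2r ?invr_gt0//.
Qed.

End Admissible.

(** * Pointwise comparison of general Cauchy densities *)

Section GeneralCauchy.
Context (R : realType).
Implicit Types (x y a b c alpha beta gamma : R).

(* Convexity of [powR ^~ gamma], applied to the average of [y * expR alpha] and
   [alpha / (1 - expR (- alpha))] with weights [expR (- alpha)] and
   [1 - expR (- alpha)]. *)
Lemma powR_shift_le gamma alpha y : 1 <= gamma -> 0 < alpha -> 0 <= y ->
  1 + (y + alpha) `^ gamma <= expR (gamma * alpha) * (1 + y `^ gamma).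
Proof.
move=> g1 al0 y0; have g0 : 0 <= gamma by exact: le_trans g1.
set e := expR (- alpha).
have e0 : 0 < e by exact: expR_gt0.
have e1 : e < 1 by rewrite expR_lt1 oppr_lt0.
have eK : e * expR alpha = 1 by rewrite -expRD addNr expR0.
have e01 : 0 <= e <= 1 by rewrite !ltW.
have e1' : 0 < 1 - e by rewrite subr_gt0.
pose t := Itv01 (ltW e0) (ltW e1).
have X0 : 0 <= y * expR alpha by rewrite mulr_ge0// expR_ge0.
have Y0 : 0 <= alpha / (1 - e) by rewrite divr_ge0// ltW.
have := @convex_powR R gamma g1 t (y * expR alpha) (alpha / (1 - e)).
rewrite !inE /= !in_itv /= !andbT X0 Y0 => /(_ isT isT).
rewrite convRE [X in X `^ _ <= _]convRE /= /unstable.onem.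
have -> : e * (y * expR alpha) + (1 - e) * (alpha / (1 - e)) = y + alpha.
  by rewrite mulrCA eK mulr1 mulrCA divff ?mulr1// gt_eqF.
have YE : (alpha / (1 - e)) `^ gamma <= expR (gamma * alpha).
  rewrite [gamma * _]mulrC expRM; apply: ge0_ler_powR; rewrite ?nnegrE// ?expR_ge0//.
  rewrite ler_pdivrMr// mulrBr mulr1 mulrC eK -lerBlDr opprK addrC.
  exact: expR_ge1Dx.
rewrite powRM ?expR_ge0// -expRM [alpha * gamma]mulrC => le_conv.
apply: (@le_trans _ _ (1 + (e * (y `^ gamma * expR (gamma * alpha)) +
  (1 - e) * expR (gamma * alpha)))).
  by rewrite lerD2l (le_trans le_conv)// lerD2l ler_wpM2l// ltW.
have K1 : 1 <= e * expR (gamma * alpha).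
  by rewrite -expRD -expR0 ler_expR addrC -mulN1r -mulrDl mulr_ge0 ?subr_ge0// ltW.
set K := expR _ in K1 *; set w := y `^ gamma.
have w0 : 0 <= w by exact: powR_ge0.
have K0 : 0 <= K by exact: expR_ge0.
have : e * (w * K) <= w * K by rewrite ler_piMl ?mulr_ge0// ltW.
lra.
Qed.

Definition cauchy_density c gamma x : R := c / (1 + `|x| `^ gamma).

Lemma measurable_cauchy_density c gamma :
  measurable_fun [set: R] (cauchy_density c gamma).
Proof.
have -> : cauchy_density c gamma =
    (fun x => c * ((1 + `|x| `^ gamma) `^ (-1))).
  by apply/funext => x; rewrite powR_inv1// addr_ge0// powR_ge0.
apply: measurable_funM; first exact: measurable_cst.
apply: (measurableT_comp (measurable_powR _)).
apply: measurable_funD; first exact: measurable_cst.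
apply: (measurableT_comp (measurable_powR _)).
exact: normr_measurable.
Qed.

(** With [K = expR (gamma * alpha)], both 1 and [a] to the power [gamma] are at most [a * K], so [1
    + v <= a * K * (1 + w) <= a * K * K * (1 + u)], and [K * K] is below the stated constant. *)
Lemma cauchy_density_affine c gamma alpha a b x : 0 <= c -> 1 < gamma -> 0 < alpha ->
  expR (- alpha) <= a <= expR alpha -> `|b| <= alpha * a ->
  cauchy_density c gamma x <=
  expR (alpha * (2 * (gamma + 1))) * (a * cauchy_density c gamma (a * x + b)).
Proof.
move=> c0 g1 al0 /andP[a_ge a_le] ba; rewrite /cauchy_density.
have a0 : 0 < a by exact: lt_le_trans (expR_gt0 _) a_ge.
have g0 : 0 <= gamma by rewrite ltW// (lt_trans _ g1).
set u := `|x| `^ gamma; set v := `|a * x + b| `^ gamma.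
have u0 : 0 <= u by exact: powR_ge0.
have v0 : 0 <= v by exact: powR_ge0.
rewrite !mulrA ler_pdivlMr ?ltr_wpDr// mulrAC ler_pdivrMr ?ltr_wpDr//.
set E := expR _; rewrite [leRHS](_ : _ = c * (E * (a * (1 + u)))); last by ring.
rewrite ler_wpM2l//.
have v_le : v <= a `^ gamma * (`|x| + alpha) `^ gamma.
  have xa0 : 0 <= `|x| + alpha by rewrite addr_ge0// ltW.
  rewrite -powRM ?(ltW a0)//; apply: ge0_ler_powR;
    rewrite ?nnegrE ?mulr_ge0 ?(ltW a0)//.
  apply: le_trans (ler_normD _ _) _; rewrite normrM (gtr0_norm a0) mulrDr lerD2l.
  by rewrite [a * _]mulrC.
have := powR_shift_le (ltW g1) al0 (normr_ge0 x); rewrite -/u => w_le.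
set w := (_ + _) `^ gamma in v_le w_le; have w0 : 0 <= w by exact: powR_ge0.
set p := a `^ gamma in v_le; have p0 : 0 <= p by exact: powR_ge0.
set K := expR (gamma * alpha) in w_le; have K1 : 1 <= K.
  by rewrite -expR0 ler_expR mulr_ge0// ltW.
have aK1 : 1 <= a * K.
  rewrite -(mulVf (lt0r_neq0 (expR_gt0 alpha))) -expRN ler_pM ?expR_ge0//.
  by rewrite ler_expR ler_peMl// ltW.
have paK : p <= a * K.
  have [a1|a1] := leP a 1.
    apply: le_trans aK1; have -> : 1 = 1 `^ gamma by rewrite powR1.
    by apply: ge0_ler_powR; rewrite ?nnegrE ?(ltW a0)// ler01.
  apply: (@le_trans _ _ K); last by rewrite ler_peMl ?expR_ge0// ltW.
  rewrite /K [gamma * _]mulrC expRM; apply: ge0_ler_powR;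
    rewrite ?nnegrE ?expR_ge0 ?(ltW a0)//.
apply: (@le_trans _ _ (a * K * (1 + w))).
  rewrite mulrDr mulr1 lerD//; apply: le_trans v_le _; exact: ler_wpM2r.
apply: (@le_trans _ _ (a * K * (K * (1 + u)))).
  by rewrite ler_wpM2l// mulr_ge0 ?expR_ge0// ltW.
rewrite [leLHS](_ : _ = (K * K) * (a * (1 + u))); last by ring.
rewrite ler_wpM2r ?mulr_ge0 ?addr_ge0 ?(ltW a0)//.
by rewrite -expRD ler_expR; lra.
Qed.

End GeneralCauchy.

(** * Robustness of Cauchy noise *)

Section AdmissibleNoise.
Context (R : realType) d (Omega : measurableType d) (Pr : probability Omega R).
Context (Z : {RV Pr >-> R}).
Implicit Types (x a b alpha beta gamma eps delta X : R).

(** [general_cauchy] yields a constant of unknown sign; total mass 1 rules out a negative one. *)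
Lemma density_constant_ge0 c (g : R -> R) : (forall x, 0 <= g x) ->
  has_density Z (fun x => c * g x) -> 0 <= c.
Proof.
move=> g0 /(_ _ measurableT); rewrite preimage_setT probability_setT => int1.
rewrite leNgt; apply/negP => c0.
have : (1 <= 0 :> \bar R)%E; last by rewrite lee_fin ler10.
rewrite int1; under eq_integral => x _ do rewrite -[_%:E]oppeK.
have cg0 x : (0 <= - (c * g x)%:E)%E by rewrite oppe_ge0 lee_fin nmulr_rle0.
by rewrite integral_ge0N ?oppe_le0 ?integral_ge0.
Qed.

Lemma admissible_general_cauchy gamma eps : 0 < eps -> 1 < gamma ->
  general_cauchy gamma Z ->
  admissible Z (eps / (2 * (gamma + 1))) (eps / (2 * (gamma + 1))) eps 0.
Proof.
move=> eps0 g1 [c Zc]; set alpha := eps / _.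
have g2 : 0 < 2 * (gamma + 1) by lra.
have al0 : 0 < alpha by rewrite divr_gt0.
have c0 : 0 <= c.
  apply: (density_constant_ge0 (g := fun x => (1 + `|x| `^ gamma)^-1)) Zc => x.
  by rewrite invr_ge0 addr_ge0// powR_ge0.
move=> a b aB ba O mO; rewrite adde0 -[_ @^-1` O]setTI.
have a0 : 0 < a by case/andP: aB => /(lt_le_trans (expR_gt0 _)).
apply: (density_affine_le _ _ Zc) => //.
- by move=> x; rewrite divr_ge0// addr_ge0// powR_ge0.
- exact: measurable_cauchy_density.
move=> x _; rewrite [X in expR X](_ : _ = alpha * (2 * (gamma + 1))).
  exact: cauchy_density_affine.
by rewrite divfK// gt_eqF.
Qed.

(** * Robustness of Laplace noise *)

Section Laplace.
Hypothesis ZL : laplace Z.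

Let laplace_density x := expR (- `|x|) / 2.

Let laplace_density_ge0 x : 0 <= laplace_density x.
Proof. by rewrite divr_ge0// expR_ge0. Qed.

Let measurable_laplace_density : measurable_fun [set: R] laplace_density.
Proof.
apply: measurable_funM; last exact: measurable_cst.
apply: (measurableT_comp (@measurable_expR R)).
apply: (measurableT_comp (@oppr_measurable R _)).
exact: normr_measurable.
Qed.

Let laplace_affine a b k (A O : set R) : 0 < a -> measurable A -> measurable O ->
  (forall x, A x -> expR (- `|x|) <= expR k * (a * expR (- `|a * x + b|))) ->
  (Pr (Z @^-1` (A `&` affine a b @^-1` O)) <= (expR k)%:E * Pr (Z @^-1` O))%E.
Proof.
move=> a0 mA mO hA; apply: (density_affine_le _ _ ZL) => // x Ax.
by rewrite !mulrA ler_wpM2r// -mulrA; exact: hA.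
Qed.

(* Translating by X maps each tail onto a half-line and divides the density by
   [expR X], so no integral has to be computed. *)
Lemma laplace_tail X : 0 <= X ->
  (Pr (Z @^-1` [set x : R | (X < `|x|)%R]) <= (expR (- X))%:E)%E.
Proof.
move=> X0; pose neg : set R := `]-oo, 0[%classic; pose pos : set R := `]0, +oo[%classic.
have mneg : measurable neg by exact: measurable_itv.
have mpos : measurable pos by exact: measurable_itv.
pose right : set R := `]X, +oo[%classic; pose left : set R := `]-oo, (- X)[%classic.
have mright : measurable right by exact: measurable_itv.
have mleft : measurable left by exact: measurable_itv.
have right_le : (Pr (Z @^-1` right) <= (expR (- X))%:E * Pr (Z @^-1` pos))%E.
  rewrite (_ : right = right `&` affine 1 (- X) @^-1` pos); last first.
    rewrite setIidl// => x /=; rewrite /affine /right /pos /= !in_itv/= !andbT; lra.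
  apply: laplace_affine => // x; rewrite /right /= in_itv/= andbT => Xx.
  rewrite !mul1r -expRD ler_expR (gtr0_norm (le_lt_trans X0 Xx)) gtr0_norm; lra.
have left_le : (Pr (Z @^-1` left) <= (expR (- X))%:E * Pr (Z @^-1` neg))%E.
  rewrite (_ : left = left `&` affine 1 X @^-1` neg); last first.
    rewrite setIidl// => x /=; rewrite /affine /left /neg /= !in_itv/=; lra.
  apply: laplace_affine => // x; rewrite /left /= in_itv/= => xX.
  rewrite !mul1r -expRD ler_expR ltr0_norm ?ltr0_norm; lra.
have -> : [set x : R | X < `|x|] = right `|` left.
  apply/seteqP; split=> x; rewrite /right /left /= !in_itv/= !andbT.
    by rewrite ltr_normr => /orP[]; [left|right; lra].
  by rewrite ltr_normr => -[Xx|xX]; apply/orP; [left|right; lra].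
rewrite preimage_setU.
apply: (@le_trans _ _ (Pr (Z @^-1` right) + Pr (Z @^-1` left))%E).
  by apply: measureU2; exact: measurable_preimage_RV.
apply: le_trans (leeD right_le left_le) _.
rewrite -ge0_muleDr// -measureU//; last 3 first.
- exact: measurable_preimage_RV.
- exact: measurable_preimage_RV.
- rewrite -subset0 => w []; rewrite /pos /neg /= !in_itv/= andbT; lra.
rewrite -[leRHS]mule1; apply: lee_wpmul2l; first by rewrite lee_fin expR_ge0.
by apply: probability_le1; apply: measurableU; exact: measurable_preimage_RV.
Qed.

Lemma expR_le_quadratic x : 0 <= x <= 1 -> expR x <= 1 + x + 2 * x ^+ 2.
Proof.
move=> /andP[x0 x1]; have half : 1 - x / 2 <= expR (- (x / 2)) by rewrite expR_ge1Dx.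
have half0 : 0 < 1 - x / 2 by lra.
have -> : expR x = (expR (- (x / 2)) ^+ 2)^-1.
  by rewrite -expRM_natr -expRN; congr expR; lra.
have sq : (1 - x / 2) ^+ 2 <= expR (- (x / 2)) ^+ 2.
  by apply: lerXn2r; rewrite ?nnegrE ?expR_ge0 ?(ltW half0).
have q0 : 0 <= 1 + x + 2 * x ^+ 2 by rewrite !addr_ge0// mulr_ge0// sqr_ge0.
rewrite -div1r ler_pdivrMr ?exprn_gt0 ?expR_gt0//.
apply: le_trans (ler_wpM2l q0 sq).
(* This is exactly [(1 + x + 2 * x ^+ 2) * (1 - x / 2) ^+ 2 - 1]. *)
have : 0 <= x ^+ 2 * ((1 - x) * (5 / 4 - x / 2)).
  by rewrite mulr_ge0 ?sqr_ge0// mulr_ge0//; lra.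
by rewrite !expr2; lra.
Qed.

(** The budget is halved: [alpha = eps / 2] for the translation, and [beta * L = eps / 2] for a
    dilation [a > 1] out to the tail cut-off. *)
Lemma admissible_laplace eps delta : 0 < eps -> eps < 1 -> 0 < delta < 1 ->
  admissible Z (eps / 2) (eps / (2 * ln (2 / delta))) eps delta.
Proof.
move=> eps0 eps1 /andP[delta0 delta1]; set L := ln (2 / delta).
set beta := eps / (2 * L).
have ln_ge (y : R) : 0 < y -> 1 - y^-1 <= ln y.
  by move=> y0; have := expR_ge1Dx (- ln y); rewrite expRN lnK// addrC; lra.
have L_ge : 1 - delta / 2 <= L.
  by have := ln_ge (2 / delta); rewrite invf_div; apply; rewrite divr_gt0.
have ln2_ge : 1 / 2 <= ln 2 :> R by have := ln_ge 2; lra.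
have L0 : 0 < L by lra.
have betaL : beta * L = eps / 2.
  by rewrite /beta; field; rewrite gt_eqF.
have beta0 : 0 < beta by rewrite divr_gt0// mulr_gt0.
move=> a b /andP[a_ge a_le] ba O mO.
have a0 : 0 < a by exact: lt_le_trans (expR_gt0 _) a_ge.
have mO1 : measurable (affine a b @^-1` O : set R) by exact: measurable_preimage_affine.
have fin (B : set R) : measurable B -> Pr (Z @^-1` B) \is a fin_num.
  by move=> mB; apply: fin_num_measure; exact: measurable_preimage_RV.
have norm_le x : `|a * x + b| <= a * `|x| + eps / 2 * a.
  apply: le_trans (ler_normD _ _) _.
  by rewrite normrM (gtr0_norm a0) lerD2l.
(* For [a <= 1] the density ratio is at most [expR (eps / 2 + beta)], which can
   exceed [expR eps] when delta is close to 1; delta then absorbs the excess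
   probability, at most [beta - eps / 2]. *)
have [a1|a1] := leP a 1.
  have bounded : (Pr (Z @^-1` (affine a b @^-1` O)) <=
      (expR (eps / 2 + beta))%:E * Pr (Z @^-1` O))%E.
    rewrite -[X in Z @^-1` X]setTI; apply: laplace_affine => // x _.
    apply: (@le_trans _ _ (expR (eps / 2 + beta) *
        (expR (- beta) * expR (- `|a * x + b|)))).
      rewrite -!expRD ler_expR; have := norm_le x.
      have : a * `|x| <= `|x| by rewrite ler_piMl.
      have : eps / 2 * a <= eps / 2 by rewrite ler_piMr// ltW// divr_gt0.
      lra.
    by rewrite ler_pM2l ?expR_gt0// ler_pM2r ?expR_gt0.
  have := probability_le1 Pr (measurable_preimage_RV Z mO1).
  have := measure_ge0 Pr (Z @^-1` (affine a b @^-1` O)).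
  move: bounded; rewrite -(fineK (fin _ mO)) -(fineK (fin _ mO1)).
  set p1 := fine _; set p2 := fine _.
  rewrite -!EFinM -EFinD !lee_fin => p12 p1_0 p1_1.
  have {}p1_0 : 0 <= p1 by exact: fine_ge0.
  (* The left side is [beta * (1 - L)], with [1 - L <= delta / 2]; and [L >= 1 / 2] gives
     [beta <= eps < 1]. *)
  have slack : beta - eps / 2 <= delta.
    have b1 : beta * (1 / 2) <= beta * L by rewrite ler_pM2l//; lra.
    have : beta * (1 - L) <= beta * (delta / 2) by rewrite ler_pM2l//; lra.
    have : beta * (delta / 2) <= delta / 2.
      by rewrite ler_piMl ?divr_ge0 ?(ltW delta0)//; lra.
    by lra.
  have e1 : 1 + (eps / 2 - beta) <= expR (eps / 2 - beta) by exact: expR_ge1Dx.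
  have step : expR (eps / 2 - beta) * p1 <= expR eps * p2.
    have -> : eps = (eps / 2 - beta) + (eps / 2 + beta) by lra.
    rewrite [in leRHS]expRD -[leRHS]mulrA [X in X - beta](_ : _ = eps / 2); last by lra.
    by rewrite ler_wpM2l ?expR_ge0.
  have : (1 + (eps / 2 - beta)) * p1 <= expR (eps / 2 - beta) * p1 by exact: ler_wpM2r.
  have : (beta - eps / 2) * p1 <= delta * p1 by exact: ler_wpM2r.
  have : delta * p1 <= delta by rewrite ler_piMr// ltW.
  by lra.
(* For [a > 1] the density ratio is at most [expR eps] where [`|x| <= X], and the
   tail beyond X has probability at most delta. *)
have la0 : 0 < ln a by rewrite ln_gt0.
have aE : expR (ln a) = a by rewrite lnK.
have la_le : ln a <= beta by rewrite -ler_expR aE.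
have laL : ln a * L <= eps / 2 by rewrite -betaL ler_pM2r.
(* At this radius the tail bound [expR (- X)] equals [delta]; moreover [X + eps / 2 <= L], because
   [ln 2 >= 1 / 2]. *)
pose X := ln (delta^-1).
have XE : X = L - ln 2.
  by rewrite /L lnM ?posrE ?invr_gt0// /X; lra.
have X0 : 0 <= X by rewrite ln_ge0// invf_ge1// ltW.
pose A : set R := [set x : R | `|x| <= X].
have mA : measurable A.
  rewrite (_ : A = `[- X, X]%classic); first exact: measurable_itv.
  by apply/seteqP; split=> x; rewrite /A /= in_itv/= ler_norml.
have AC : ~` A = [set x : R | (X < `|x|)%R].
  by apply/seteqP; split=> x; rewrite /A /= ltNge => /negP.
(* The exponent inequality for the density ratio at the worst case [|x| = X]; the quadratic bound on
   [a = expR (ln a)] needs [ln a <= 1], which follows from [ln a * L <= eps / 2]. *)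
have small : (a - 1) * (X + eps / 2) <= ln a + eps / 2.
  have quad : a <= 1 + ln a + 2 * ln a ^+ 2.
    rewrite -{1}aE; apply: expR_le_quadratic; rewrite (ltW la0)/=.
    have : ln a * (1 / 2) <= ln a * L by rewrite ler_pM2l//; lra.
    lra.
  apply: (@le_trans _ _ ((ln a + 2 * ln a ^+ 2) * L)).
    apply: ler_pM; rewrite ?subr_ge0 ?(ltW a1)//; lra.
  have : 2 * ln a * (ln a * L) <= 2 * ln a * (1 / 2).
    by rewrite ler_pM2l ?mulr_gt0//; lra.
  rewrite expr2; lra.
apply: (@le_trans _ _ (Pr (Z @^-1` (A `&` affine a b @^-1` O)) +
                       Pr (Z @^-1` [set x : R | (X < `|x|)%R]))%E).
  apply: le_trans (measureU2 _ _ _); rewrite -?preimage_setU; last 2 first.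
  - exact: measurable_preimage_RV (measurableI _ _ mA mO1).
  - by apply: measurable_preimage_RV; rewrite -AC; exact: measurableC.
  apply: le_measure; rewrite ?inE; first exact: measurable_preimage_RV.
  - apply: measurable_preimage_RV; apply: measurableU; first exact: measurableI.
    by rewrite -AC; exact: measurableC.
  - move=> w /= Ow; have [wX|wX] := leP `|Z w| X; [by left|by right].
apply: leeD.
  apply: laplace_affine => // x Ax.
  rewrite -{1}aE -!expRD ler_expR; have := norm_le x.
  have : (a - 1) * `|x| <= (a - 1) * X by rewrite ler_wpM2l// subr_ge0 ltW.
  move: small; lra.
apply: le_trans (laplace_tail X0) _.
by rewrite lee_fin expRN lnK ?posrE ?invr_gt0// invrK.
Qed.

End Laplace.

End AdmissibleNoise.

Theorem theorem3 (R : realType) (S : setting)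
    (Ctx : Type) (policy : Ctx -> relid S -> pubinfo S) (c : Ctx)
    (rl : relid S -> rule)
    (rlP : forall i, i \in priv S -> rule_applies (policy c) i (rl i)) :
  (forall beta : R, 0 < beta ->
     smooth_upper_bound (policy c) beta (CRS (policy c) rl beta) /\
     forall D : instance S, legal D ->
       (CRS (policy c) rl beta D <= RS beta D)%E) /\
  (forall (d : measure_display) (Omega : measurableType d)
      (Pr : probability Omega R) (Z : {RV Pr >-> R}) (eps : R), 0 < eps ->
    (forall gamma : R, 1 < gamma -> general_cauchy gamma Z ->
       let alpha := eps / (2 * (gamma + 1)) in
       let beta := eps / (2 * (gamma + 1)) in
       contextual_dp (policy c) eps 0
         (release (CRS (policy c) rl beta) alpha Z)) /\
    (forall delta : R, eps < 1 -> 0 < delta < 1 -> laplace Z ->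
       let alpha := eps / 2 in
       let beta := eps / (2 * ln (2 / delta)) in
       contextual_dp (policy c) eps delta
         (release (CRS (policy c) rl beta) alpha Z))).
Proof.
have smooth (beta : R) D D' : ctx_neighbors (policy c) D D' ->
    [/\ (CRS (policy c) rl beta D <= (expR beta)%:E * CRS (policy c) rl beta D')%E,
        (CRS (policy c) rl beta D' <= (expR beta)%:E * CRS (policy c) rl beta D)%E
      & (size_dist R D D' <= CRS (policy c) rl beta D)%E].
  by move=> DD'; have [] := CRS_smooth beta rlP DD'; split=> //;
    exact: size_dist_le_CRS.
split=> [beta beta0|d Omega Pr Z eps eps0].
  split=> [|D _]; last exact: CRS_le_RS.
  split=> [D _|D _|D D' /(smooth beta)[]//]; first exact: CRS_fin.
  exact: CLS_le_CRS.
split=> [gamma gamma1 ZC|delta eps1 /andP[delta0 delta1] ZL] alpha beta.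
  have alpha0 : 0 < alpha by rewrite divr_gt0// mulr_gt0//; lra.
  apply: (admissible_release (beta := beta)) => //.
  - exact: ltW.
  - by move=> D; exact: CRS_fin.
  - by move=> D; exact: CRS_ge0.
  - exact: smooth.
  - exact: admissible_general_cauchy.
have beta0 : 0 < beta.
  by rewrite divr_gt0// mulr_gt0// ln_gt0// ltr_pdivlMr// mul1r; lra.
apply: (admissible_release (beta := beta)).
- by rewrite divr_gt0.
- exact: ltW.
- exact: ltW.
- by move=> D; exact: CRS_fin.
- by move=> D; exact: CRS_ge0.
- exact: smooth.
- by apply: admissible_laplace => //; rewrite delta0.
Qed.
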